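(* Let $G$ be a graph of order $n$ with diameter $\operatorname{diam}(G)=2$. (i) If $G\notin\{K_{1,n-1},C_5\}$, then $s^+(G)\ge n$. (ii) $s^-(G)\ge n-O(\sqrt{n\log n})$; that is, there is an absolute constant $C>0$ such that every graph $G$ of order $n\ge 2$ with diameter $2$ satisfies $s^-(G)\ge n-C\sqrt{n\log n}$.
   Context: All graphs are finite and simple. For a graph $G$ with adjacency matrix $A(G)$ and eigenvalues $\lambda_1(G)\ge\cdots\ge\lambda_n(G)$, define $s^+(G)=\sum_{\lambda_i(G)>0}\lambda_i(G)^2$ and $s^-(G)=\sum_{\lambda_i(G)<0}\lambda_i(G)^2$. $K_{1,n-1}$ is the star on $n$ vertices and $C_5$ is the cycle on $5$ vertices. *)

(* Defs.v *)
From HB Require Import structures.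
From mathcomp Require Import all_boot all_order all_algebra.
From mathcomp Require Import spectral complex polyrcf.

Set Implicit Arguments.
Unset Strict Implicit.
Unset Printing Implicit Defensive.

Import Order.TTheory GRing.Theory Num.Theory.

Local Open Scope ring_scope.

Record sgraph := SGraph {
  vertex :> finType;
  adj : rel vertex;
  adj_sym : symmetric adj;
  adj_irr : irreflexive adj
}.

Definition isomorphic (G H : sgraph) : Prop :=
  exists f : G -> H, bijective f /\ forall x y, adj (f x) (f y) = adj x y.

(* K_{1,n-1}: the centre is vertex 0, so two vertices are adjacent exactly
   when one and only one of them is 0. *)
Definition star_rel (n : nat) : rel 'I_n :=
  fun i j => (i == 0 :> nat)%N != (j == 0 :> nat)%N.

Lemma star_rel_sym n : symmetric (@star_rel n).
Proof. by move=> i j; rewrite /star_rel eq_sym. Qed.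

Lemma star_rel_irr n : irreflexive (@star_rel n).
Proof. by move=> i; rewrite /star_rel eqxx. Qed.

Definition star (n : nat) : sgraph :=
  SGraph (@star_rel_sym n) (@star_rel_irr n).

Definition C5_rel : rel 'I_5 :=
  fun i j => (j == i.+1 %% 5 :> nat)%N || (i == j.+1 %% 5 :> nat)%N.

Lemma C5_rel_sym : symmetric C5_rel.
Proof. by move=> i j; rewrite /C5_rel orbC. Qed.

Lemma C5_rel_irr : irreflexive C5_rel.
Proof. by case; do 5?[case=> //]. Qed.

Definition C5 : sgraph := SGraph C5_rel_sym C5_rel_irr.

Definition is_walk (G : sgraph) (x y : G) (p : seq G) : Prop :=
  path (@adj G) x p /\ last x p = y.

Definition is_dist (G : sgraph) (x y : G) (d : nat) : Prop :=
  (exists2 p, is_walk x y p & size p = d) /\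
  (forall p, is_walk x y p -> (d <= size p)%N).

(* Distance and diameter are relations because they are infinite for a
   disconnected graph: [has_diam G d] forces G to be connected. *)
Definition has_diam (G : sgraph) (d : nat) : Prop :=
  (exists x y : G, is_dist x y d) /\
  (forall x y : G, exists2 k, is_dist x y k & (k <= d)%N).

(* The real eigenvalues of A, repeated according to their multiplicity as roots
   of the characteristic polynomial; for a symmetric A these are all the
   eigenvalues ([char_poly_eigenvalues]). *)
Definition eigenvalues (R : rcfType) (n : nat) (A : 'M[R]_n) : seq R :=
  flatten [seq nseq (mup x (char_poly A)) x | x <- rev (rootsR (char_poly A))].

Lemma char_poly_sym_splits (R : rcfType) n (A : 'M[R]_n) : A^T = A ->
  exists s : seq R, char_poly A = \prod_(x <- s) ('X - x%:P).
Proof.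
move=> symA; pose f := real_complex R.
have hA : map_mx f A \is hermsymmx.
  apply: realsym_hermsym.
    by apply/is_hermitianmxP; rewrite expr0 scale1r map_mx_id // map_trmx symA.
  by apply/mxOverP => i j; rewrite mxE /f complex_real.
have /hermitian_spectral_diag_real/mxOverP dR := hA.
have /hermitian_normalmx/orthomx_spectralP Adiag := hA.
set P := spectralmx _ in Adiag; set d := spectral_diag _ in Adiag dR.
have uP : P \in unitmx by exact: spectral_unit.
exists [seq complex.Re (d 0 i) | i <- enum 'I_n].
apply: (map_poly_inj f); rewrite map_char_poly rmorph_prod big_map big_enum /=.
have -> : char_poly (map_mx f A) = char_poly (diag_mx d).
  rewrite Adiag /char_poly /char_poly_mx !map_mxM.
  set Q := map_mx polyC P; set Q' := map_mx polyC (invmx P).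
  have QQ : Q' *m Q = 1%:M by rewrite -map_mxM mulVmx // map_mx1.
  have -> : 'X%:M - Q' *m map_mx polyC (diag_mx d) *m Q =
            Q' *m ('X%:M - map_mx polyC (diag_mx d)) *m Q.
    by rewrite mulmxBr mulmxBl mul_mx_scalar -scalemxAl QQ scalemx1.
  by rewrite !det_mulmx mulrC mulrA -det_mulmx (mulmx1C QQ) det1 mul1r.
rewrite char_poly_trig ?diag_mx_is_trig //; apply: eq_bigr => i _.
rewrite rmorphB /= map_polyX map_polyC /= mxE eqxx mulr1n /f.
by rewrite -[in LHS](RRe_real (dR 0 i)).
Qed.

Lemma char_poly_eigenvalues (R : rcfType) n (A : 'M[R]_n) : A^T = A ->
  char_poly A = \prod_(x <- eigenvalues A) ('X - x%:P).
Proof.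
move=> /char_poly_sym_splits[s sE]; have p0 := monic_neq0 (char_poly_monic A).
rewrite [LHS]sE; apply/perm_big/allP => x _ /=.
rewrite -[X in X == _]mu_prod_XsubC -sE count_flatten -map_comp sumnE big_map.
under eq_bigr do rewrite /= count_nseq /=.
have [xr|xNr] := boolP (x \in rev (rootsR (char_poly A))).
  rewrite (bigD1_seq x) ?rev_uniq ?uniq_roots //= eqxx mul1n big1 ?addn0 //.
  by move=> y /negbTE ->; rewrite mul0n.
rewrite mupNroot; last first.
  by move: xNr; rewrite mem_rev -roots_on_rootsR // inE.
rewrite big_seq big1 // => y yr; have [xy|] := eqVneq; last by rewrite mul0n.
by rewrite -xy yr in xNr.
Qed.

Lemma sorted_eigenvalues (R : rcfType) n (A : 'M[R]_n) :
  sorted >=%R (eigenvalues A).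
Proof.
rewrite sorted_pairwise; last by move=> y x z xy yz; exact: le_trans yz xy.
rewrite /eigenvalues; have : sorted >%R (rev (rootsR (char_poly A))).
  by rewrite rev_sorted sorted_roots.
rewrite sorted_pairwise; last by move=> y x z xy yz; exact: lt_trans yz xy.
elim: (rev _) => //= x r IH /andP[/allP xr /IH{}IH].
rewrite pairwise_cat IH andbT; apply/andP; split.
  apply/allrelP => y z; rewrite mem_nseq => /andP[_ /eqP->].
  move=> /flatten_mapP[t tr]; rewrite mem_nseq => /andP[_ /eqP->].
  exact/ltW/xr.
elim: (mup _ _) => //= m ->; rewrite andbT; apply/allP => y.
rewrite mem_nseq => /andP[_ /eqP->]; exact: lexx.
Qed.

Definition adj_mx (R : rcfType) (G : sgraph) : 'M[R]_#|G| :=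
  \matrix_(i, j) (adj (enum_val i) (enum_val j))%:R.

Lemma adj_mx_sym (R : rcfType) (G : sgraph) : (adj_mx R G)^T = adj_mx R G.
Proof. by apply/matrixP => i j; rewrite !mxE adj_sym. Qed.

Definition splus (R : rcfType) (G : sgraph) : R :=
  \sum_(x <- eigenvalues (adj_mx R G) | 0 < x) x ^+ 2.

Definition sminus (R : rcfType) (G : sgraph) : R :=
  \sum_(x <- eigenvalues (adj_mx R G) | x < 0) x ^+ 2.

(* Main.v *)
Require Import Defs.
From mathcomp Require Import all_boot all_order all_algebra.
From mathcomp Require Import perm reals exp ring lra.

(* Let [A = P - Q] be the decomposition of the adjacency matrix into its
   positive and negative parts, so that [s^+ = |P|^2 = <A, P>].

   Negative energy. If [z] assigns to each vertex a vector of norm at most 1,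
   Schur's product theorem applied to [P], [P] and the Gram matrix [M] of [z]
   gives [s^- >= \sum (1 - 1 / (1 - M_xy))] over ordered pairs of adjacent
   vertices. A suitable [z] (regular simplices for disjoint cliques) shows
   that [s^- >= n - |D|] for a dominating set [D], and that
   [s^- >= n - 2 n / d] when all degrees are at least [d]. In diameter 2 the
   neighbours of a vertex form a dominating set, so comparing the minimum
   degree with [sqrt n] gives even [s^- >= n - 2 sqrt n].

   Positive energy. In diameter 2 the number of walks of length 2 shows that
   the squared degrees sum to at least [n (n - 1)], whence
   [lambda_1^2 >= n - 1], and [lambda_1^2 >= n] if each vertex is on a triangle
   or on a (not necessarily induced) 4-cycle. An induced [2 K_2] supplies
   [lambda_2 >= 1]. Without induced [2 K_2] and without universal vertex, the
   cycle condition holds if there is a triangle or if G is bipartite; otherwise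
   G contains a pentagon, on which the second eigenvalue of [C5] supplies what
   is missing. With a universal vertex, one adds to the positive part of the
   spanning star the one of an edge between two leaves. *)

Set Implicit Arguments.
Unset Strict Implicit.
Unset Printing Implicit Defensive.

Import Order.TTheory GRing.Theory Num.Theory.

Local Open Scope ring_scope.


(** * Real spectral theorem *)

(** If [w = x - e] is nonzero, [H] is the reflection in the hyperplane orthogonal to [w], which
    exchanges the unit vectors [x] and [e]; [s] is the squared norm of [w]. *)
Lemma householder (R : realFieldType) n (x : 'cV[R]_n.+1) :
  x^T *m x = 1%:M ->
  exists H : 'M[R]_n.+1,
    [/\ H^T = H, H *m H = 1%:M & H *m x = delta_mx 0 0].
Proof.
move=> xx; set e : 'cV[R]_n.+1 := delta_mx 0 0; pose w := x - e.
have ee : e^T *m e = 1%:M.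
  by rewrite trmx_delta mul_delta_mx; apply/matrixP=> i j; rewrite !ord1 !mxE.
have exE : e^T *m x = (x 0 0)%:M.
  rewrite trmx_delta -rowE; apply/matrixP=> i j.
  by rewrite !ord1 !mxE eqxx mulr1n.
have xeE : x^T *m e = (x 0 0)%:M by rewrite -[e]trmxK -trmx_mul exE tr_scalar_mx.
pose s : R := 2 - 2 * x 0 0.
have wT : w^T = x^T - e^T by rewrite /w linearB.
have ww : w^T *m w = s%:M.
  rewrite wT mulmxBl !mulmxBr xx ee exE xeE -!raddfB /=.
  by congr _%:M; rewrite /s; ring.
have wx : w^T *m x = (1 - x 0 0)%:M.
  by rewrite wT mulmxBl xx exE -raddfB.
have [w0|wn0] := eqVneq w 0.
  exists 1%:M; split; rewrite ?trmx1 ?mulmx1 ?mul1mx //.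
  by apply/eqP; rewrite -subr_eq0 -/e -/w w0.
have s0 : s != 0.
  apply: contra_neq wn0 => s0; apply/matrixP => i j; rewrite !mxE.
  have /matrixP/(_ 0 0) := ww; rewrite s0 !mxE mul0rn => /eqP.
  rewrite psumr_eq0 => [/allP/(_ i (mem_index_enum _))|k _]; last first.
    by rewrite mxE -expr2 sqr_ge0.
  by rewrite !ord1 mxE mulf_eq0 orbb !mxE => /eqP.
exists (1%:M - (2 / s) *: (w *m w^T)); split.
- by rewrite linearB /= trmx1 linearZ /= trmx_mul trmxK.
- rewrite mulmxBl mul1mx mulmxBr mulmx1 -scalemxAl -scalemxAr scalerA.
  rewrite mulmxA -(mulmxA w) ww mul_mx_scalar -scalemxAl scalerA.
  apply/matrixP=> i j; rewrite !mxE; field; exact: s0.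
- rewrite mulmxBl mul1mx -scalemxAl -mulmxA wx mul_mx_scalar scalerA.
  have -> : 2 / s * (1 - x 0 0) = 1 by rewrite {1}/s; field; move: s0; rewrite /s; apply.
  by rewrite scale1r /w opprB addrC subrK.
Qed.

Lemma sym_unit_eigenvector (R : rcfType) n (A : 'M[R]_n.+1) :
  A^T = A -> exists (a : R) (x : 'cV[R]_n.+1), x^T *m x = 1%:M /\ A *m x = a *: x.
Proof.
move=> symA; have [s sE] := char_poly_sym_splits symA.
case: s sE => [|a s] sE.
  by have := size_char_poly A; rewrite sE big_nil size_poly1.
have /eigenvalueP[v vA v0] : eigenvalue A a.
  by rewrite eigenvalue_root_char sE big_cons rootM root_XsubC eqxx.
have vAT : A *m v^T = a *: v^T by rewrite -{1}symA -trmx_mul vA linearZ.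
pose t := (v *m v^T) 0 0.
have t0 : 0 < t.
  rewrite lt0r /t mxE; apply/andP; split; last first.
    by apply: sumr_ge0 => i _; rewrite mxE -expr2 sqr_ge0.
  apply: contra_neq v0 => /eqP; rewrite psumr_eq0 => [/allP vi|i _]; last first.
    by rewrite mxE -expr2 sqr_ge0.
  apply/matrixP => i j; have := vi j (mem_index_enum _).
  by rewrite mxE mulf_eq0 orbb ord1 mxE => /eqP.
exists a, ((Num.sqrt t)^-1 *: v^T); split; last first.
  by rewrite -scalemxAr vAT !scalerA mulrC.
have -> : ((Num.sqrt t)^-1 *: v^T)^T = (Num.sqrt t)^-1 *: v.
  by rewrite linearZ /= trmxK.
rewrite -scalemxAl -scalemxAr scalerA -expr2 exprVn.
rewrite sqr_sqrtr ?ltW //.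
have -> : v *m v^T = t%:M.
  by apply/matrixP=> i j; rewrite !ord1 [RHS]mxE eqxx mulr1n.
by rewrite scale_scalar_mx mulVf ?gt_eqF.
Qed.

(** By induction: a reflection sending a unit eigenvector to the first basis vector clears the first
    column, hence by symmetry the first row, and leaves a smaller symmetric block. *)
Lemma sym_spectral (R : rcfType) n (A : 'M[R]_n) : A^T = A ->
  exists (U : 'M[R]_n) (d : 'rV[R]_n),
    U^T *m U = 1%:M /\ A = U *m diag_mx d *m U^T.
Proof.
elim: n A => [|n IHn] A symA.
  by exists 0, 0; split; apply/matrixP; case.
have [a [x [xx Ax]]] := sym_unit_eigenvector symA.
have [H [HT HH Hx]] := householder xx.
have [B BdE] : {B : 'M[R]_(1 + n) | B = H *m A *m H} by exists (H *m A *m H).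
have BT : B^T = B by rewrite BdE !trmx_mul HT symA mulmxA.
have Be : B *m delta_mx 0 0 = a *: (delta_mx 0 0 : 'cV[R]_(1 + n)).
  by rewrite -Hx BdE -!mulmxA (mulmxA H H) HH mul1mx Ax -scalemxAr.
have Bi0 i : B i 0 = a * (i == 0)%:R.
  by have /matrixP/(_ i 0) := Be; rewrite -colE !mxE eqxx andbT.
have ulB : ulsubmx B = a%:M.
  apply/matrixP=> i j; rewrite !ord1 !mxE eqxx.
  have -> : lshift n 0 = 0 :> 'I_(1 + n) by apply: val_inj.
  by rewrite Bi0 eqxx mulr1.
have dlB : dlsubmx B = 0.
  apply/matrixP=> i j; rewrite !ord1 !mxE.
  have -> : lshift n 0 = 0 :> 'I_(1 + n) by apply: val_inj.
  by rewrite Bi0 mulr0.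
have urB : ursubmx B = 0 by rewrite -[B]BT -trmx_dlsub dlB trmx0.
have drT : (drsubmx B)^T = drsubmx B by rewrite trmx_drsub BT.
have [U [d [UU drE]]] := IHn _ drT.
have BE : B = block_mx a%:M 0 0 (drsubmx B).
  by rewrite -{1}[B]submxK ulB dlB urB.
pose V : 'M[R]_(1 + n) := block_mx 1%:M 0 0 U.
have VT : V^T = block_mx 1%:M 0 0 U^T.
  by rewrite /V tr_block_mx !trmx0 trmx1.
have VV : V^T *m V = 1%:M.
  rewrite VT /V mulmx_block !mulmx0 !mul0mx mulmx1 UU.
  by rewrite !addr0 add0r -scalar_mx_block.
pose D : 'rV[R]_(1 + n) := row_mx a%:M d.
have BV : B = V *m diag_mx D *m V^T.
  rewrite BE drE VT /V /D diag_mx_row !mulmx_block.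
  rewrite !mulmx0 !mul0mx !addr0 !add0r mulmx1 mul1mx !mul0mx ?mulmx0.
  by congr block_mx; apply/matrixP=> i j; rewrite !ord1 !mxE eqxx.
have HHB : A = H *m B *m H by rewrite BdE !mulmxA HH mul1mx -mulmxA HH mulmx1.
exists (H *m V), D; split.
  by rewrite trmx_mul HT mulmxA -[V^T *m H *m H]mulmxA HH mulmx1.
by rewrite HHB BV trmx_mul HT !mulmxA.
Qed.

(** Both lists are the roots of one characteristic polynomial with multiplicities, so the energies
    can be read off any orthogonal diagonalisation. *)
Lemma perm_eigenvalues (R : rcfType) n (U : 'M[R]_n) (d : 'rV[R]_n) :
  U^T *m U = 1%:M ->
  perm_eq (eigenvalues (U *m diag_mx d *m U^T)) [seq d 0 i | i <- enum 'I_n].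
Proof.
move=> UU; set A := U *m diag_mx d *m U^T.
have symA : A^T = A by rewrite /A !trmx_mul trmxK tr_diag_mx mulmxA.
have charE : char_poly A = \prod_(x <- [seq d 0 i | i <- enum 'I_n]) ('X - x%:P).
  rewrite big_map big_enum /=; transitivity (char_poly (diag_mx d)).
    rewrite /A /char_poly /char_poly_mx !map_mxM.
    set Q := map_mx polyC U; set Q' := map_mx polyC U^T.
    have QQ : Q *m Q' = 1%:M by rewrite -map_mxM (mulmx1C UU) map_mx1.
    have -> : 'X%:M - Q *m map_mx polyC (diag_mx d) *m Q' =
              Q *m ('X%:M - map_mx polyC (diag_mx d)) *m Q'.
      by rewrite mulmxBr mulmxBl mul_mx_scalar -scalemxAl QQ scalemx1.
    by rewrite !det_mulmx mulrC mulrA -det_mulmx (mulmx1C QQ) det1 mul1r.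
  rewrite char_poly_trig ?diag_mx_is_trig //; apply: eq_bigr => i _.
  by rewrite mxE eqxx mulr1n.
apply/allP => x _ /=; rewrite -[X in X == _]mu_prod_XsubC -[X in _ == X]mu_prod_XsubC.
by rewrite -char_poly_eigenvalues // charE.
Qed.

(** The left side is [\tr (M *m N^T)], invariant under orthogonal conjugation. *)
Lemma sum_mulmx_diag (R : comNzRingType) n (U : 'M[R]_n) (d f : 'rV[R]_n) :
  U^T *m U = 1%:M ->
  \sum_i \sum_j (U *m diag_mx d *m U^T) i j * (U *m diag_mx f *m U^T) i j =
  \sum_k d 0 k * f 0 k.
Proof.
move=> UU; set M := U *m _ *m _; set N := U *m diag_mx f *m _.
transitivity (\tr (M *m N^T)).
  by apply: eq_bigr => i _; rewrite mxE; apply: eq_bigr => j _; rewrite !mxE.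
rewrite /M /N !trmx_mul trmxK tr_diag_mx -!mulmxA (mulmxA U^T) UU mul1mx.
rewrite mxtrace_mulC -!mulmxA UU mulmx1 mulmx_diag mxtrace_diag.
by apply: eq_bigr => k _; rewrite mxE.
Qed.

Lemma mul_diag_trE (R : comNzRingType) n (U : 'M[R]_n) (d : 'rV[R]_n) i j :
  (U *m diag_mx d *m U^T) i j = \sum_k d 0 k * (U i k * U j k).
Proof.
rewrite mxE; apply: eq_bigr => k _; rewrite mul_mx_diag !mxE.
by rewrite mulrA [U i k * _]mulrC.
Qed.

Lemma sum_enum_val (R : nmodType) (T : finType) (F : T -> R) :
  \sum_(i < #|T|) F (enum_val i) = \sum_x F x.
Proof. by rewrite -(big_enum_val F). Qed.

(** * Spectral decomposition and Perron vector of the adjacency matrix *)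

Section Spectrum.
Context {R : rcfType} (G : sgraph).
Implicit Types (x y : G) (p : G -> R).

Definition adjr x y : R := (adj x y)%:R.

Lemma adjrC x y : adjr x y = adjr y x. Proof. by rewrite /adjr adj_sym. Qed.
Lemma adjr_ge0 x y : 0 <= adjr x y. Proof. exact: ler0n. Qed.

Definition qform p : R := \sum_x \sum_y adjr x y * (p x * p y).
Definition dot p q : R := \sum_x p x * q x.

Lemma adj_mxE i j : adj_mx R G i j = adjr (enum_val i) (enum_val j).
Proof. by rewrite mxE. Qed.

(* [P = \sum_k Y_k Y_k^T] is the positive part of the adjacency matrix, and
   [\sum_k Z_k Z_k^T] the negative one. *)
Lemma spectral_split : exists Y Z : 'I_#|G| -> G -> R,
  let P x y := \sum_k Y k x * Y k y in
  [/\ forall x y, P x y - adjr x y = \sum_k Z k x * Z k y,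
      \sum_x \sum_y P x y ^+ 2 = splus R G,
      \sum_x \sum_y adjr x y * P x y = splus R G &
      splus R G + sminus R G = \sum_x \sum_y adjr x y].
Proof.
have [U [d [UU AE]]] := sym_spectral (adj_mx_sym R G).
pose dp : 'rV[R]_#|G| := \row_k Num.max (d 0 k) 0.
have dp0 k : 0 <= dp 0 k by rewrite mxE le_max lexx orbT.
have dd0 k : 0 <= dp 0 k - d 0 k by rewrite subr_ge0 mxE le_max lexx.
have perm := perm_eigenvalues d UU; rewrite -AE in perm.
have sumE0 (Q : pred R) : \sum_(x <- eigenvalues (adj_mx R G) | Q x) x ^+ 2 =
    \sum_k (if Q (d 0 k) then d 0 k ^+ 2 else 0).
  by rewrite (perm_big _ perm) big_map big_enum_cond /= big_mkcond.
have spE : splus R G = \sum_k dp 0 k * dp 0 k.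
  rewrite /splus sumE0; apply: eq_bigr => k _; rewrite mxE.
  by case: ltrP => [dk|dk]; rewrite ?expr2 ?mulr0.
have smE : splus R G + sminus R G = \sum_k d 0 k * d 0 k.
  rewrite /splus /sminus !sumE0 -big_split; apply: eq_bigr => k _ /=.
  by case: ltrgtP => [dk|dk|<-]; rewrite ?addr0 ?add0r ?expr2 ?mulr0.
pose Y k x := U (enum_rank x) k * Num.sqrt (dp 0 k).
pose Z k x := U (enum_rank x) k * Num.sqrt (dp 0 k - d 0 k).
have YE i j : \sum_k Y k (enum_val i) * Y k (enum_val j) =
              (U *m diag_mx dp *m U^T) i j.
  rewrite mul_diag_trE; apply: eq_bigr => k _; rewrite /Y !enum_valK.
  by rewrite mulrACA -expr2 sqr_sqrtr // mulrC.
have aE i j : adjr (enum_val i) (enum_val j) = (U *m diag_mx d *m U^T) i j.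
  by rewrite -AE adj_mxE.
have sumE (F : G -> G -> R) :
    \sum_x \sum_y F x y =
    \sum_(i < #|G|) \sum_(j < #|G|) F (enum_val i) (enum_val j).
  rewrite -[LHS]sum_enum_val; by apply: eq_bigr => i _; rewrite -[LHS]sum_enum_val.
exists Y, Z; split.
- move=> x y; rewrite -[x]enum_rankK -[y]enum_rankK YE aE !mul_diag_trE -sumrB.
  apply: eq_bigr => k _; rewrite /Z !enum_valK mulrACA -expr2 sqr_sqrtr //.
  by rewrite [RHS]mulrC mulrBl.
- rewrite sumE spE -(sum_mulmx_diag _ _ UU); apply: eq_bigr => i _.
  by apply: eq_bigr => j _; rewrite YE expr2.
- rewrite sumE spE.
  (* Where [dp] is nonzero it equals [d]. *)
  transitivity (\sum_k d 0 k * dp 0 k).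
    rewrite -(sum_mulmx_diag _ _ UU); apply: eq_bigr => i _.
    by apply: eq_bigr => j _; rewrite YE aE.
  apply: eq_bigr => k _; rewrite mxE; case: (lerP (d 0 k) 0) => // _.
  by rewrite !mulr0.
- rewrite smE sumE -(sum_mulmx_diag _ _ UU); apply: eq_bigr => i _.
  apply: eq_bigr => j _; rewrite -aE /adjr.
  by case: (adj _ _); rewrite ?mulr1 ?mulr0.
Qed.

(** [r] is the largest modulus of an eigenvalue and [p] the entrywise absolute value of a unit
    eigenvector for it; [r <= qform p] because the matrix is nonnegative. The last bound is the
    operator norm applied to the all-ones vector. *)
Lemma perron_vector : (0 < #|G|)%N -> exists (p : G -> R) (r : R),
  [/\ 0 <= r, dot p p = 1, r <= qform p &
      \sum_x (\sum_y adjr x y) ^+ 2 <= #|G|%:R * r ^+ 2].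
Proof.
move=> G0; have [U [d [UU AE]]] := sym_spectral (adj_mx_sym R G).
pose k0 : 'I_#|G| := Ordinal G0.
pose k := [arg max_(i > k0) `|d 0 i| ]%O.
have kP i : `|d 0 i| <= `|d 0 k|.
  by rewrite /k; case: arg_maxP => //= j _; apply.
exists (fun x => `|U (enum_rank x) k|), `|d 0 k|; split; first exact: normr_ge0.
- rewrite /dot -[LHS]sum_enum_val.
  have UUk : (U^T *m U) k k = 1 by rewrite UU mxE eqxx.
  rewrite -[RHS]UUk mxE.
  apply: eq_bigr => i _; rewrite enum_valK -normrM mxE ger0_norm //.
  by rewrite -expr2 sqr_ge0.
- have -> : d 0 k = \sum_x \sum_y adjr x y * (U (enum_rank x) k * U (enum_rank y) k).
    have AU : adj_mx R G *m U = U *m diag_mx d by rewrite AE -!mulmxA UU mulmx1.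
    have : U^T *m (adj_mx R G *m U) = diag_mx d by rewrite AU mulmxA UU mul1mx.
    move=> /matrixP/(_ k k); rewrite [in X in _ = X -> _]mxE eqxx mulr1n => <-.
    rewrite mxE -[RHS]sum_enum_val; apply: eq_bigr => i _; rewrite mxE mxE mulr_sumr.
    rewrite -[RHS]sum_enum_val; apply: eq_bigr => j _; rewrite !enum_valK adj_mxE.
    by rewrite mulrCA.
  apply: le_trans (ler_norm_sum _ _ _) _; apply: ler_sum => x _.
  apply: le_trans (ler_norm_sum _ _ _) _; apply: ler_sum => y _.
  by rewrite !normrM (ger0_norm (adjr_ge0 _ _)).
- pose o : 'cV[R]_#|G| := const_mx 1.
  have normE m (v : 'cV[R]_m) : (v^T *m v) 0 0 = \sum_i v i 0 ^+ 2.
    by rewrite mxE; apply: eq_bigr => i _; rewrite mxE expr2.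
  have -> : \sum_x (\sum_y adjr x y) ^+ 2 = ((adj_mx R G *m o)^T *m (adj_mx R G *m o)) 0 0.
    rewrite normE -[LHS]sum_enum_val; apply: eq_bigr => i _; congr (_ ^+ 2).
    rewrite mxE -[LHS]sum_enum_val; apply: eq_bigr => j _.
    by rewrite adj_mxE mxE mulr1.
  pose s := U^T *m o.
  have Ao : adj_mx R G *m o = U *m (diag_mx d *m s) by rewrite AE -!mulmxA.
  have -> : (adj_mx R G *m o)^T *m (adj_mx R G *m o) =
            (diag_mx d *m s)^T *m (diag_mx d *m s).
    by rewrite Ao trmx_mul -mulmxA (mulmxA U^T) UU mul1mx.
  have -> : #|G|%:R = (s^T *m s) 0 0.
    have -> : s^T *m s = o^T *m o.
      by rewrite /s trmx_mul trmxK -mulmxA (mulmxA U) (mulmx1C UU) mul1mx.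
    rewrite normE (eq_bigr (fun=> 1)) => [|i _]; last by rewrite mxE expr1n.
    by rewrite sumr_const card_ord.
  rewrite !normE mulr_suml; apply: ler_sum => i _.
  rewrite mul_diag_mx mxE exprMn mulrC ler_wpM2l ?sqr_ge0 //.
  by rewrite -[_ ^+ 2]ger0_norm ?sqr_ge0 // normrX lerXn2r ?nnegrE.
Qed.

End Spectrum.

(** * Test matrices for the square energies *)

Section Tests.
Context {R : rcfType} (G : sgraph).
Implicit Types (x y : G) (p v : G -> R).

Lemma gram_form (I : finType) (Z : I -> G -> R) v :
  \sum_x \sum_y (\sum_k Z k x * Z k y) * (v x * v y) = \sum_k dot (Z k) v ^+ 2.
Proof.
transitivity (\sum_x \sum_k \sum_y (Z k x * v x) * (Z k y * v y)).
  apply: eq_bigr => x _; rewrite exchange_big; apply: eq_bigr => y _ /=.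
  by rewrite mulr_suml; apply: eq_bigr => k _; rewrite mulrACA.
rewrite exchange_big; apply: eq_bigr => k _ /=; rewrite expr2 /dot mulr_suml.
by apply: eq_bigr => x _; rewrite mulr_sumr.
Qed.

Lemma sum_rank1 p v : \sum_x \sum_y (p x * p y) * (v x * v y) = dot p v ^+ 2.
Proof.
rewrite expr2 /dot mulr_suml; apply: eq_bigr => x _; rewrite mulr_sumr.
by apply: eq_bigr => y _; rewrite mulrACA.
Qed.

(* Testing the positive part against [X = s p p^T + t v v^T]: this bounds
   [2 <A, X> - |X|^2]. *)
Lemma splus_test p v (s t : R) : 0 <= s -> 0 <= t ->
  2 * (s * qform p + t * qform v) -
    (s ^+ 2 * dot p p ^+ 2 + 2 * s * t * dot p v ^+ 2 + t ^+ 2 * dot v v ^+ 2)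
  <= splus R G.
Proof.
move=> s0 t0; have [Y [Z [ZE <- _ _]]] := spectral_split (R := R) G.
set P := fun x y => \sum_k Y k x * Y k y in ZE *.
pose N x y := P x y - adjr x y.
have NE q : 0 <= \sum_x \sum_y N x y * (q x * q y).
  under eq_bigr do under eq_bigr do rewrite /N ZE.
  by rewrite gram_form; apply: sumr_ge0 => k _; rewrite sqr_ge0.
have -> : 2 * (s * qform p + t * qform v) -
    (s ^+ 2 * dot p p ^+ 2 + 2 * s * t * dot p v ^+ 2 + t ^+ 2 * dot v v ^+ 2) =
  \sum_x \sum_y (2 * s * (adjr x y * (p x * p y)) + 2 * t * (adjr x y * (v x * v y))
    - s ^+ 2 * ((p x * p y) * (p x * p y))
    - 2 * s * t * ((p x * p y) * (v x * v y))
    - t ^+ 2 * ((v x * v y) * (v x * v y))).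
  under eq_bigr do rewrite !(big_split, sumrN) -!mulr_sumr /=.
  rewrite !(big_split, sumrN) /= -!mulr_sumr !sum_rank1 -/(qform p) -/(qform v).
  by ring.
(* [N] is the negative part, so replacing [adjr] by [P] can only increase the linear terms; then
   [2 P X - X^2 <= P^2] entrywise. *)
have NN : 0 <= \sum_x \sum_y (2 * s * (N x y * (p x * p y)) +
                             2 * t * (N x y * (v x * v y))).
  under eq_bigr do rewrite big_split -!mulr_sumr /=.
  rewrite big_split -!mulr_sumr /=.
  by rewrite addr_ge0 // mulr_ge0 // mulr_ge0.
rewrite -[X in X <= _]addr0; apply: le_trans (lerD (lexx _) NN) _.
rewrite -big_split; apply: ler_sum => x _; rewrite -big_split; apply: ler_sum => y _.
rewrite /= -/(P x y) -subr_ge0 /N.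
rewrite [leRHS](_ : _ =
  (P x y - (s * (p x * p y) + t * (v x * v y))) ^+ 2) ?sqr_ge0 //.
ring.
Qed.

(** A variational form of [lambda_2 >= th]: the plane of [v1] and [v2] contains a nonzero [v]
    orthogonal to [p], and testing with [r p p^T + (th / |v|^2) v v^T] yields
    [r^2 + th^2 <= s^+]. *)
Lemma splus_two_dim (v1 v2 : G -> R) (th : R) : (0 < #|G|)%N -> 0 <= th ->
  (forall s t : R, (s != 0) || (t != 0) ->
     let v x := s * v1 x + t * v2 x in 0 < dot v v /\ th * dot v v <= qform v) ->
  \sum_x (\sum_y @adjr R G x y) ^+ 2 <= #|G|%:R * (splus R G - th ^+ 2).
Proof.
move=> G0 th0 vP; have [p [r [r0 pp pr sr]]] := perron_vector (R := R) G0.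
apply: le_trans sr _; rewrite ler_wpM2l ?ler0n //.
have dotE s t : dot p (fun x => s * v1 x + t * v2 x) = s * dot p v1 + t * dot p v2.
  rewrite /dot !mulr_sumr -big_split; apply: eq_bigr => x _ /=; ring.
have [s [t [st pv]]] : exists s t : R, (s != 0) || (t != 0) /\
    dot p (fun x => s * v1 x + t * v2 x) = 0.
  have [p1|p1] := eqVneq (dot p v1) 0.
    by exists 1, 0; rewrite oner_neq0 dotE p1; split => //; ring.
  exists (- dot p v2), (dot p v1); rewrite p1 orbT dotE; split => //; ring.
have := vP s t st; set v := fun x => _ in pv * => -[vv qv].
have c0 : 0 <= th / dot v v by rewrite divr_ge0 // ltW.
have := splus_test p v r0 c0; rewrite pp pv => H.
rewrite lerBrDr; apply: le_trans H.
have h1 : r ^+ 2 <= r * qform p by rewrite expr2 ler_wpM2l.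
have h2 : th ^+ 2 <= th / dot v v * qform v.
  by rewrite mulrAC ler_pdivlMr // expr2 -mulrA ler_wpM2l.
have -> : (th / dot v v) ^+ 2 * dot v v ^+ 2 = th ^+ 2.
  by rewrite -exprMn divfK // gt_eqF.
by move: h1 h2; rewrite expr1n expr0n /= !mulr0 mulr1; lra.
Qed.

Lemma splus_degree : (0 < #|G|)%N ->
  \sum_x (\sum_y @adjr R G x y) ^+ 2 <= #|G|%:R * splus R G.
Proof.
move=> G0; have [p [r [r0 pp pr sr]]] := perron_vector (R := R) G0.
apply: le_trans sr _; rewrite ler_wpM2l ?ler0n //.
have := splus_test p p r0 (lexx 0); rewrite pp; apply: le_trans.
have h1 : r ^+ 2 <= r * qform p by rewrite expr2 ler_wpM2l.
by rewrite expr1n mul0r addr0; lra.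
Qed.

(* The positive part [P] satisfies [\sum adjr P = \sum P^2], and [\sum M P^2 >= 0]
   by Schur's product theorem; so [2 P <= w P^2 + 1 / w] on the edges bounds
   [\sum P^2] by [\sum adjr / w]. *)
Lemma sminus_vector (I : finType) (z : I -> G -> R) (w : G -> G -> R) :
  let M x y := \sum_l z l x * z l y in
  (forall x, M x x <= 1) ->
  (forall x y, adj x y -> 0 < w x y <= 1 - M x y) ->
  \sum_x \sum_y adjr x y * (1 - (w x y)^-1) <= sminus R G.
Proof.
move=> M M1 wM; have [Y [Z [_ PE aPE sE]]] := spectral_split (R := R) G.
set P := fun x y => \sum_k Y k x * Y k y in PE aPE.
have Mle x y : M x y <= 1.
  have : 0 <= \sum_l (z l x - z l y) ^+ 2 by apply: sumr_ge0 => l _; exact: sqr_ge0.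
  have -> : \sum_l (z l x - z l y) ^+ 2 = M x x + M y y - 2 * M x y.
    rewrite /M mulr_sumr -sumrN -!big_split; apply: eq_bigr => l _ /=; ring.
  have := M1 x; have := M1 y; lra.
(* Schur's theorem made explicit: once both factors [P] are expanded along [Y], each term is a
   quadratic form of the Gram matrix of [z], hence a sum of squares. *)
have MP0 : 0 <= \sum_x \sum_y M x y * P x y ^+ 2.
  have -> : \sum_x \sum_y M x y * P x y ^+ 2 = \sum_k \sum_x \sum_y
      (\sum_l (z l x * Y k x) * (z l y * Y k y)) * P x y.
    rewrite [RHS]exchange_big; apply: eq_bigr => x _.
    rewrite [RHS]exchange_big; apply: eq_bigr => y _.
    rewrite expr2 mulrA -mulr_suml; congr (_ * _); rewrite {1}/P mulr_sumr.
    apply: eq_bigr => k _; rewrite /M mulr_suml; apply: eq_bigr => l _.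
    by rewrite mulrACA.
  apply: sumr_ge0 => k _.
  have -> : \sum_x \sum_y (\sum_l (z l x * Y k x) * (z l y * Y k y)) * P x y =
    \sum_k' \sum_x \sum_y
      (\sum_l (z l x * Y k x) * (z l y * Y k y)) * (Y k' x * Y k' y).
    rewrite [RHS]exchange_big; apply: eq_bigr => x _.
    rewrite [RHS]exchange_big; apply: eq_bigr => y _.
    by rewrite mulr_sumr.
  apply: sumr_ge0 => k' _.
  rewrite (gram_form (fun l x => z l x * Y k x)).
  by apply: sumr_ge0 => l _; exact: sqr_ge0.
have : 2 * splus R G <=
    \sum_x \sum_y (P x y ^+ 2 - M x y * P x y ^+ 2 + adjr x y * (w x y)^-1).
  rewrite -aPE mulr_sumr; apply: ler_sum => x _.
  rewrite mulr_sumr; apply: ler_sum => y _.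
  have -> : P x y ^+ 2 - M x y * P x y ^+ 2 = (1 - M x y) * P x y ^+ 2 by ring.
  rewrite /adjr; case: (boolP (adj x y)) => [xy|_]; last first.
    by rewrite !mul0r mulr0 addr0 mulr_ge0 ?sqr_ge0 // subr_ge0.
  have /andP[w0 wle] := wM _ _ xy; rewrite !mul1r.
  apply: (@le_trans _ _ (w x y * P x y ^+ 2 + (w x y)^-1)); last first.
    by rewrite lerD2r ler_wpM2r ?sqr_ge0.
  rewrite -subr_ge0.
  have -> : w x y * P x y ^+ 2 + (w x y)^-1 - 2 * P x y =
            (w x y)^-1 * (w x y * P x y - 1) ^+ 2.
    by field; rewrite gt_eqF.
  by rewrite mulr_ge0 ?sqr_ge0 // invr_ge0 ltW.
under eq_bigr do rewrite !(big_split, sumrN) /=.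
rewrite !(big_split, sumrN) /= PE => H.
(* By [H] and [MP0], [s^+] is at most [\sum adjr / w], and the two energies add up to
   [\sum adjr]. *)
under eq_bigr do under eq_bigr do rewrite mulrBr mulr1.
under eq_bigr do rewrite big_split sumrN /=.
rewrite big_split sumrN /= -sE; move: H MP0; lra.
Qed.

End Tests.

(** * Negative square energy and domination *)

Lemma sum_delta (R : pzSemiRingType) (T : finType) (x : T) (F : T -> R) :
  \sum_w (w == x)%:R * F w = F x.
Proof.
rewrite (bigD1 x) //= eqxx mul1r big1 ?addr0 // => w /negbTE ->.
by rewrite mul0r.
Qed.

Lemma sum_mem (R : pzSemiRingType) (T : finType) (A : {set T}) :
  \sum_w (w \in A)%:R = #|A|%:R :> R.
Proof. by rewrite -sum1_card natr_sum [RHS]big_mkcond; apply: eq_bigr => w _; case: ifP. Qed.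

(** Meant for [A = cnbh x] and [s = 1 / #|A|]: the first factor is then a vertex of the regular
    simplex on [A], moved so that its centre is the origin. *)
Lemma sum_centred (R : fieldType) (T : finType) (x y : T) (A B : {set T}) (s t : R) :
  \sum_w ((w == x)%:R - (w \in A)%:R * s) * ((w == y)%:R - (w \in B)%:R * t) =
  (x == y)%:R - (x \in B)%:R * t - (y \in A)%:R * s + #|A :&: B|%:R * (s * t).
Proof.
have -> : #|A :&: B|%:R * (s * t) = \sum_w (w \in A)%:R * s * ((w \in B)%:R * t).
  rewrite -sum_mem mulr_suml; apply: eq_bigr => w _; rewrite inE -mulnb natrM.
  by rewrite mulrACA.
rewrite -(sum_delta x (fun w => (w == y)%:R)) -(sum_delta x (fun w => (w \in B)%:R * t)).
rewrite -(sum_delta y (fun w => (w \in A)%:R * s)) -!sumrN -!big_split.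
by apply: eq_bigr => w _ /=; ring.
Qed.

(** * Test vectors from a vertex set and a choice of centres *)

Section Centres.
Context {R : rcfType} (G : sgraph) (D : {set G}) (cen : G -> option G).
Hypothesis cenP : forall u d, u \notin D -> cen u = Some d -> d \in D /\ adj u d.
Implicit Types (x y u : G).

Definition cnbh x := [set v | (v \notin D) && ((v == x) || adj x v)].
Let m x : R := #|cnbh x|%:R.
Let k x : R := Num.sqrt (1 + (m x)^-1).

(* [G + G] indexes an orthonormal basis, a vector [e_d] and a vector [f_w] for
   each vertex. A vertex [d] of [D] gets [e_d]; the other ones get
   [- e_(cen x) / m + k (f_x - 1 / m \sum_(w in cnbh x) f_w)], of norm 1 (the
   first term is missing if [cen x = None]). Adjacent [x] and [y] outside [D]
   then have a scalar product of at most [- 1 / min (m x) (m y)]. *)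
Let z (l : G + G) x : R :=
  match l with
  | inl d => if x \in D then (d == x)%:R else - ((cen x == Some d)%:R / m x)
  | inr w => if x \in D then 0 else k x * ((w == x)%:R - (w \in cnbh x)%:R / m x)
  end.

(** [- h] bounds the scalar products along edges ([M_adj]), and [1 + h] is the weight passed to
    [sminus_vector]. *)
Let h x y : R :=
  if x \in D then (if y \in D then 0 else (cen y == Some x)%:R / m y)
  else if y \in D then (cen x == Some y)%:R / m x else (Num.min (m x) (m y))^-1.

Let mem_cnbh x : x \notin D -> x \in cnbh x.
Proof. by move=> xD; rewrite inE xD eqxx. Qed.

Let m_ge1 x : x \notin D -> 1 <= m x.
Proof.
by move=> xD; rewrite /m ler1n card_gt0; apply/set0Pn; exists x; exact: mem_cnbh.
Qed.

Let k_sqr x : k x ^+ 2 = 1 + (m x)^-1.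
Proof. by rewrite sqr_sqrtr // addr_ge0 // invr_ge0 ler0n. Qed.

Let M x y := \sum_l z l x * z l y.

Let ME x y : M x y = \sum_d z (inl d) x * z (inl d) y + \sum_w z (inr w) x * z (inr w) y.
Proof. by rewrite /M big_sumType. Qed.

Let MC x y : M x y = M y x.
Proof. by apply: eq_bigr => l _; rewrite mulrC. Qed.

Let sum_cen x : \sum_d (cen x == Some d)%:R = (cen x != None)%:R :> R.
Proof.
case: (cen x) => [c|]; last by rewrite big1.
transitivity (\sum_d (d == c)%:R * 1 : R); last by rewrite sum_delta.
by apply: eq_bigr => d _; rewrite mulr1 eq_sym.
Qed.

Let sum_cen2 x y :
  \sum_d (cen x == Some d)%:R * (cen y == Some d)%:R <= 1 :> R.
Proof.
apply: (@le_trans _ _ (\sum_d (cen x == Some d)%:R)).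
  apply: ler_sum => d _; rewrite -[leRHS]mulr1 ler_wpM2l ?ler0n //.
  by rewrite lern1 leq_b1.
by rewrite sum_cen lern1 leq_b1.
Qed.

Let M_diag x : M x x <= 1.
Proof.
rewrite ME /=; have [xD|xD] := boolP (x \in D).
  rewrite [X in _ + X](_ : _ = 0) ?addr0; last by rewrite big1 // => w _; rewrite mul0r.
  by rewrite (sum_delta x (fun d => (d == x)%:R)) eqxx.
have m1 := m_ge1 xD.
(* The simplex part has squared norm [(1 + 1 / m) (1 - 1 / m) = 1 - 1 / m^2]: [k] is chosen to leave
   just the [1 / m^2] of the centre component. *)
have -> : \sum_w k x * ((w == x)%:R - (w \in cnbh x)%:R / m x) *
      (k x * ((w == x)%:R - (w \in cnbh x)%:R / m x)) = 1 - (m x)^-1 ^+ 2.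
  under eq_bigr do rewrite mulrACA.
  rewrite -mulr_sumr sum_centred eqxx mem_cnbh // setIid -/(m x) -expr2 k_sqr mulr1n.
  by field; lra.
have -> : \sum_d - ((cen x == Some d)%:R / m x) * - ((cen x == Some d)%:R / m x) =
   (m x)^-1 ^+ 2 * \sum_d (cen x == Some d)%:R * (cen x == Some d)%:R.
  by rewrite mulr_sumr; apply: eq_bigr => d _; ring.
rewrite addrC -lerBrDl; apply: le_trans (_ : (m x)^-1 ^+ 2 * 1 <= _); last by lra.
by rewrite ler_wpM2l ?sqr_ge0.
Qed.

(** The two neighbourhoods share at most [m x] vertices, so the unscaled simplex parts have product
    at most [- 1 / m x]. As [k x >= k y], the factor [k x * k y >= 1 + 1 / m y] gains a further
    [1 / (m x * m y)], which pays for a common centre. *)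
Let M_out x y : x \notin D -> y \notin D -> adj x y -> m x <= m y ->
  M x y <= - (m x)^-1.
Proof.
move=> xD yD xy mxy; have mx1 := m_ge1 xD; have my1 := m_ge1 yD.
have mx0 : 0 < m x by lra.
have my0 : 0 < m y by lra.
rewrite ME /= (negbTE xD) (negbTE yD).
have -> : \sum_w k x * ((w == x)%:R - (w \in cnbh x)%:R / m x) *
      (k y * ((w == y)%:R - (w \in cnbh y)%:R / m y)) =
    k x * k y * (- (m y)^-1 - (m x)^-1
                 + #|cnbh x :&: cnbh y|%:R * ((m x)^-1 * (m y)^-1)).
  under eq_bigr do rewrite mulrACA.
  rewrite -mulr_sumr sum_centred.
  have -> : (x == y) = false by apply: contraTF xy => /eqP ->; rewrite adj_irr.
  rewrite mulr0n.
  have -> : x \in cnbh y by rewrite inE xD adj_sym xy orbT.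
  have -> : y \in cnbh x by rewrite inE yD xy orbT.
  by rewrite mulr1n; congr (_ * _); ring.
have -> : \sum_d - ((cen x == Some d)%:R / m x) * - ((cen y == Some d)%:R / m y) =
   ((m x)^-1 * (m y)^-1) * \sum_d (cen x == Some d)%:R * (cen y == Some d)%:R.
  by rewrite mulr_sumr; apply: eq_bigr => d _; ring.
set s := \sum_d _; set q := #|_|%:R.
have ix : 0 < (m x)^-1 by rewrite invr_gt0.
have iy : 0 < (m y)^-1 by rewrite invr_gt0.
have ixy : (m y)^-1 <= (m x)^-1 by rewrite lef_pV2 ?posrE.
have s1 : (m x)^-1 * (m y)^-1 * s <= (m x)^-1 * (m y)^-1.
  by rewrite -[leRHS]mulr1 ler_wpM2l ?sum_cen2 // mulr_ge0 // ltW.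
have q1 : q * ((m x)^-1 * (m y)^-1) <= (m y)^-1.
  rewrite mulrA ler_piMl ?(ltW iy) // ler_pdivrMr // mul1r /q ler_nat.
  by rewrite subset_leq_card // subsetIl.
have kk : 1 + (m y)^-1 <= k x * k y.
  rewrite -k_sqr expr2 ler_wpM2r ?sqrtr_ge0 // ler_sqrt ?lerD2l //.
  by rewrite addr_ge0 // ltW.
have : k x * k y * (- (m y)^-1 - (m x)^-1 + q * ((m x)^-1 * (m y)^-1)) <=
       k x * k y * - (m x)^-1.
  by rewrite ler_wpM2l ?mulr_ge0 ?sqrtr_ge0 //; lra.
have : (1 + (m y)^-1) * (m x)^-1 <= k x * k y * (m x)^-1.
  by rewrite ler_wpM2r // ltW.
have -> : (1 + (m y)^-1) * (m x)^-1 = (m x)^-1 + (m x)^-1 * (m y)^-1 by ring.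
by rewrite !mulrN; lra.
Qed.

Let hC x y : h x y = h y x.
Proof. by rewrite /h; case: ifP; case: ifP => // _ _; rewrite minC. Qed.

Let h_ge0 x y : 0 <= h x y.
Proof.
rewrite /h; case: ifP => _; case: ifP => _; rewrite ?divr_ge0 ?ler0n //.
by rewrite invr_ge0 le_min !ler0n.
Qed.

Let M_adj x y : adj x y -> M x y <= - h x y.
Proof.
(* A vertex [u] of [D] carries only [e_u], so the product is the coordinate of [v] on [e_u]. *)
have half u v : u \in D -> adj u v -> M u v <= - h u v.
  move=> uD uv; rewrite ME /h /= uD; rewrite [X in _ + X](_ : _ = 0) ?addr0; last first.
    by rewrite big1 // => w _; rewrite mul0r.
  rewrite (sum_delta u (fun d => if v \in D then (d == v)%:R else _)).
  case: ifP => _ //; rewrite oppr0 (_ : u == v = false) //.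
  by apply: contraTF uv => /eqP ->; rewrite adj_irr.
move=> xy; have [xD|xD] := boolP (x \in D); first exact: half.
have [yD|yD] := boolP (y \in D); first by rewrite MC hC half // adj_sym.
rewrite /h (negbTE xD) (negbTE yD); case: (leP (m x) (m y)) => mxy.
  exact: M_out.
by rewrite MC; apply: M_out; rewrite // 1?adj_sym // ltW.
Qed.

(** Each of the [m x - 1] ordered edges from [x] that stay outside [D] gives at least
    [1 / (m x + 1)]. The edge to the centre counts in both orders and gives [2 / (m x + 1)]: in
    total 1 with a centre, [1 - 2 / (m x + 1)] without. *)
Lemma sminus_centres :
  \sum_(u | u \notin D) (1 - (cen u == None)%:R * (2 / (#|cnbh u|%:R + 1))) <=
  sminus R G.
Proof.
have wP x y : adj x y -> 0 < 1 + h x y <= 1 - M x y.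
  by move=> /M_adj; have := h_ge0 x y => h0 Mh; apply/andP; split; lra.
apply: le_trans (sminus_vector M_diag wP).
pose e x : R := (m x + 1)^-1.
have e_ge0 x : 0 <= e x by rewrite invr_ge0 addr_ge0 ?ler0n.
pose f x y : R := ((x \notin D) && (cen x == Some y))%:R * e x.
pose o x y : R := [&& x \notin D, y \notin D & adj x y]%:R * e x.
apply: (@le_trans _ _ (\sum_x \sum_y (o x y + f x y + f y x))).
  have -> : \sum_x \sum_y (o x y + f x y + f y x) =
            \sum_x \sum_y (o x y + f x y *+ 2).
    under eq_bigr do rewrite big_split; rewrite big_split /= [X in _ + X]exchange_big.
    by rewrite -big_split; apply: eq_bigr => x _; rewrite -big_split;
       apply: eq_bigr => y _ /=; rewrite mulr2n addrA.
  rewrite [leLHS]big_mkcond; apply: ler_sum => x _.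
  case: ifPn => xD; last first.
    by apply: sumr_ge0 => y _; rewrite addr_ge0 ?mulrn_wge0 ?mulr_ge0.
  have oE : \sum_y o x y = (m x - 1) * e x.
    rewrite -mulr_suml; congr (_ * _); apply/esym/eqP; rewrite subr_eq; apply/eqP.
    rewrite {1}/m -sum_mem [LHS](bigD1 x) //= mem_cnbh // addrC; congr (_ + _).
    rewrite [RHS](bigD1 x) //= adj_irr !andbF add0r; apply: eq_bigr => y yx.
    by rewrite inE (negbTE yx) xD.
  have fE : \sum_y f x y = (cen x != None)%:R * e x.
    by rewrite -mulr_suml -sum_cen xD.
  rewrite big_split /= sumrMnl oE fE -/(m x) /e; have m1 := m_ge1 xD.
  have m0 : m x + 1 != 0 by lra.
  rewrite -mulrnAr; case: (cen x) => [c|] /=.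
    by rewrite mul0r subr0 mul1r le_eqVlt; apply/orP; left; apply/eqP; field.
  by rewrite mul1r mul0r addr0 le_eqVlt; apply/orP; left; apply/eqP; field.
apply: ler_sum => x _; apply: ler_sum => y _.
have inve t : 0 < t -> 1 - (1 + t^-1)^-1 = (t + 1)^-1 :> R.
  by move=> t0; field; lra.
have g_ge0 : 0 <= adjr x y * (1 - (1 + h x y)^-1) :> R.
  rewrite mulr_ge0 ?adjr_ge0 // subr_ge0 invf_le1; have := h_ge0 x y; lra.
have [xD|xD] := boolP (x \in D); have [yD|yD] := boolP (y \in D);
  rewrite /o /f ?xD ?yD ?(negbTE xD) ?(negbTE yD) /= ?mul0r ?add0r ?addr0 //.
- have [cy|_] := eqVneq (cen y) (Some x); last by rewrite mul0r.
  have [_ yx] := cenP yD cy.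
  have m1 := m_ge1 yD.
  rewrite /adjr adj_sym yx /h xD (negbTE yD) cy eqxx !mul1r inve //; lra.
- have [cx|_] := eqVneq (cen x) (Some y); last by rewrite mul0r.
  have [_ xy] := cenP xD cx.
  have m1 := m_ge1 xD.
  rewrite /adjr xy /h yD (negbTE xD) cx eqxx !mul1r inve //; lra.
- have -> : (cen x == Some y) = false.
    by apply: contraNF yD => /eqP cx; have [] := cenP xD cx.
  have -> : (cen y == Some x) = false.
    by apply: contraNF xD => /eqP cy; have [] := cenP yD cy.
  rewrite !mul0r !addr0; move: g_ge0; rewrite /adjr; case: (boolP (adj x y)) => [_ _|_ _].
    have m1 := m_ge1 xD; have m2 := m_ge1 yD.
    have mm : 0 < Num.min (m x) (m y) by rewrite lt_min; apply/andP; split; lra.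
    rewrite !mul1r /h (negbTE xD) (negbTE yD) inve // /e lef_pV2 ?posrE; try lra.
    by rewrite lerD2r ge_min lexx.
  by rewrite !mul0r.
Qed.

End Centres.

(** * Negative square energy in diameter 2 *)

Lemma diam2_common (G : sgraph) (x y : G) :
  has_diam G 2 -> x != y -> ~~ adj x y -> exists2 w, adj x w & adj w y.
Proof.
move=> [_ /(_ x y)[k [[p [xp <-] <-] _] p2]]; case: p xp p2 => [|w [|w' [|? ?]]] //=.
- by rewrite eqxx.
- by rewrite andbT => -> .
- by rewrite andbT => /andP[xw ww'] _ _ _; exists w.
Qed.

(** From [exp (- 1 / 2) >= 1 - 1 / 2]. It serves to compare [sqrt n] with [sqrt (n ln n)]. *)
Lemma ln_natr_ge (R : realType) n : (2 <= n)%N -> 2^-1 <= ln (n%:R : R).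
Proof.
move=> n2; apply: (@le_trans _ _ (ln 2)); last first.
  by rewrite ler_ln ?posrE ?ltr0n ?ler_nat // (leq_trans _ n2).
rewrite -[leLHS]expRK ler_ln ?posrE ?expR_gt0 // -[2^-1]opprK expRN.
rewrite -[leRHS]invrK lef_pV2 ?posrE ?invr_gt0 ?expR_gt0 //.
by apply: le_trans (expR_ge1Dx _); lra.
Qed.

(** [cen] picks a dominating neighbour, so every vertex outside [D] contributes a full 1. *)
Lemma sminus_dominating (R : rcfType) (G : sgraph) (D : {set G}) :
  (forall u, u \notin D -> exists2 d, d \in D & adj u d) ->
  #|G|%:R - #|D|%:R <= sminus R G.
Proof.
move=> domD; pose cen u := [pick d in D | adj u d].
have cenP u d : u \notin D -> cen u = Some d -> d \in D /\ adj u d.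
  by rewrite /cen; case: pickP => // c /andP[cD uc] _ [<-].
apply: le_trans (sminus_centres (R := R) cenP).
rewrite (eq_bigr (fun=> 1)) => [|u uD]; last first.
  have -> : (cen u == None) = false.
    rewrite /cen; case: pickP => // noc; have [d dD ud] := domD u uD.
    by have := noc d; rewrite dD ud.
  by rewrite mul0r subr0.
rewrite lerBlDr sumr_const -natrD ler_nat -(cardC D) addnC.
by rewrite leq_add2r subset_leq_card //; apply/subsetP => x; rewrite !inE.
Qed.

(** With [D] empty and no centres, [cnbh] is the closed neighbourhood, and each vertex loses at most
    [2 / s]. *)
Lemma sminus_min_degree (R : rcfType) (G : sgraph) (s : R) : 0 < s ->
  (forall u : G, s <= #|adj u|%:R) -> #|G|%:R - 2 * (#|G|%:R / s) <= sminus R G.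
Proof.
move=> s0 degs; pose cen (u : G) := @None G.
have cenP u d : u \notin (set0 : {set G}) -> cen u = Some d ->
    d \in (set0 : {set G}) /\ adj u d by [].
apply: le_trans (sminus_centres (R := R) cenP).
have -> : #|G|%:R - 2 * (#|G|%:R / s) = \sum_(u : G) (1 - 2 / s) :> R.
  by rewrite sumr_const -[RHS]mulr_natl; ring.
rewrite [leRHS]big_mkcond; apply: ler_sum => u _; rewrite inE /= mul1r.
rewrite lerD2l lerN2 ler_pM2l // lef_pV2 ?posrE ?ltr_wpDl ?ler0n //.
apply: le_trans (degs u) _; apply: (@le_trans _ _ #|cnbh set0 u|%:R); last by lra.
by rewrite ler_nat subset_leq_card //; apply/subsetP => v; rewrite !inE => uv; apply/orP; right.
Qed.

Lemma sminus_diam2 (R : realType) (G : sgraph) : (2 <= #|G|)%N -> has_diam G 2 ->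
  #|G|%:R - 4 * Num.sqrt (#|G|%:R * ln (#|G|%:R : R)) <= sminus R G.
Proof.
move=> n2 diamG; set n : R := #|G|%:R; pose s := Num.sqrt n.
have n0 : 0 < n by rewrite ltr0n (leq_trans _ n2).
have s0 : 0 < s by rewrite sqrtr_gt0.
have sE : s ^+ 2 = n by rewrite sqr_sqrtr // ltW.
(* [4 sqrt (n ln n) = 2 sqrt (4 n ln n)], and [4 ln n >= 2]. *)
have logs : n - 4 * Num.sqrt (n * ln n) <= n - 2 * s.
  rewrite lerD2l lerN2 -[4](_ : 2 * 2 = 4 :> R); last by lra.
  rewrite -mulrA ler_pM2l // -[X in X * _](@ger0_norm R) // -sqrtr_sqr -sqrtrM ?sqr_ge0 //.
  have ln1 := ln_natr_ge R n2; rewrite -/n in ln1.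
  rewrite ler_sqrt; last by rewrite mulr_ge0 ?sqr_ge0 // mulr_ge0; lra.
  by rewrite mulrCA ler_peMr; lra.
apply: le_trans logs _.
have [/existsP[v vs]|/existsPn degs] := boolP [exists v : G, #|adj v|%:R <= s].
  apply: (@le_trans _ _ (n - #|[set w | adj v w]|%:R)).
    rewrite cardsE; lra.
  apply: sminus_dominating => u; rewrite inE => vu.
  have [->|uv] := eqVneq u v; last first.
    rewrite eq_sym in uv.
    by have [w vw wu] := diam2_common diamG uv vu; exists w; rewrite ?inE // adj_sym.
  (* [v] lies outside its own neighbourhood and is dominated as soon as it has a neighbour; a second
     vertex provides one. *)
  have [w wv] : exists w, w != v.
    apply/existsP; rewrite -[X in is_true X]negbK negb_exists; apply/forallPn.
    move: n2; rewrite (cardD1 v) inE ltnS => /card_gt0P[w]; rewrite !inE andbT => wv.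
    by exists w; rewrite negbK.
  have [vw|nvw] := boolP (adj v w); first by exists w; rewrite ?inE.
  rewrite eq_sym in wv.
  by have [t vt _] := diam2_common diamG wv nvw; exists t; rewrite ?inE.
apply: le_trans (sminus_min_degree s0 _); last by move=> u; have := degs u; rewrite -ltNge => /ltW.
by have -> : n / s = s by rewrite -sE expr2 mulfK ?gt_eqF.
Qed.

(** * Positive square energy *)

Definition walks (G : sgraph) (x y : G) : nat :=
  (adj x y + #|[set w | adj x w && adj w y]|)%N.

(** In diameter 2 every [y != x] is reached by at least one walk of length 1 or 2. A second walk to
    some [y] means that [x] lies on a triangle or on a 4-cycle. *)
Definition excess (G : sgraph) (x : G) : Prop :=
  exists2 y, y != x & (1 < walks x y)%N.

Section Excess.
Variable G : sgraph.
Implicit Types x y w : G.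

Lemma excess_triangle x y w : adj x y -> adj x w -> adj w y -> excess x.
Proof.
move=> xy xw wy; exists y; first by apply: contraTneq xy => ->; rewrite adj_irr.
rewrite /walks xy add1n ltnS card_gt0; apply/set0Pn; exists w.
by rewrite inE xw wy.
Qed.

Lemma excess_square x y w w' : y != x -> w != w' ->
  adj x w -> adj w y -> adj x w' -> adj w' y -> excess x.
Proof.
move=> yx ww' xw wy xw' w'y; exists y => //; rewrite /walks.
apply: leq_trans (leq_addl _ _).
have sub : [set w; w'] \subset [set t | adj x t && adj t y].
  by apply/subsetP => t; rewrite !inE => /orP[]/eqP ->; apply/andP.
by apply: leq_trans (subset_leq_card sub); rewrite cards2 ww'.
Qed.

(* The sum of squared degrees is that of all codegrees; the diagonal ones are
   the degrees, and provide the terms [adj x y] of [walks x y]. *)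
Lemma sum_degree_sq (R : rcfType) (S : {set G}) :
  (forall x y, x != y -> ~~ adj x y -> exists2 w, adj x w & adj w y) ->
  (forall x, x \in S -> excess x) ->
  #|G|%:R * (#|G|%:R - 1) + #|S|%:R <= \sum_x (\sum_y @adjr R G x y) ^+ 2.
Proof.
move=> com exS.
pose c x y : R := #|[set w | adj x w && adj w y]|%:R.
have cE x y : c x y = \sum_w adjr x w * adjr w y.
  rewrite /c -sum_mem; apply: eq_bigr => w _.
  by rewrite inE -mulnb natrM.
have -> : \sum_x (\sum_y @adjr R G x y) ^+ 2 = \sum_x \sum_y c x y.
  transitivity (\sum_w \sum_x \sum_y @adjr R G x w * adjr w y).
    apply: eq_bigr => w _; rewrite expr2 mulr_suml; apply: eq_bigr => x _.
    by rewrite mulr_sumr; apply: eq_bigr => y _; rewrite [adjr x w]adjrC.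
  rewrite exchange_big; apply: eq_bigr => x _ /=; rewrite exchange_big.
  by apply: eq_bigr => y _; rewrite cE.
have -> : #|G|%:R * (#|G|%:R - 1) + #|S|%:R =
    \sum_(x : G) (#|G|%:R - 1 + (x \in S)%:R) :> R.
  by rewrite big_split /= sum_mem sumr_const mulr_natl.
apply: ler_sum => x _.
have walks_gt0 y : y != x -> (0 < walks x y)%N.
  move=> yx; rewrite /walks; case: (boolP (adj x y)) => // nxy; rewrite add0n card_gt0.
  rewrite eq_sym in yx; have [w xw wy] := com x y yx nxy.
  by apply/set0Pn; exists w; rewrite inE xw.
have -> : \sum_y c x y = (\sum_(y | y != x) walks x y)%:R.
  rewrite natr_sum (bigD1 x) //=; under [RHS]eq_bigr do rewrite /walks natrD.
  rewrite big_split /=; congr (_ + _).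
  rewrite cE (bigD1 x) //= /adjr adj_irr mul0r add0r; apply: eq_bigr => w _.
  by rewrite adj_sym -natrM mulnb andbb.
have -> : #|G|%:R - 1 + (x \in S)%:R = (#|predC1 x| + (x \in S))%:R :> R.
  by rewrite (cardC1 x) natrD -subn1 natrB // (cardD1 x).
rewrite ler_nat -sum1_card.
have [xS|_] := boolP (x \in S); last first.
  by rewrite addn0; apply: leq_sum => y; exact: walks_gt0.
have [y yx w2] := exS x xS.
rewrite (bigD1 y) //= [leqRHS](bigD1 y) //= addnAC leq_add //.
by apply: leq_sum => t /andP[tx _]; exact: walks_gt0.
Qed.

End Excess.

(** * Lower bounds for the positive square energy *)

Section LowerBounds.
Context {R : rcfType} (G : sgraph).
Hypothesis com : forall x y : G,
  x != y -> ~~ adj x y -> exists2 w, adj x w & adj w y.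

Lemma splus_excess : (0 < #|G|)%N -> (forall x : G, excess x) ->
  #|G|%:R <= splus R G.
Proof.
move=> G0 exG; have exS (x : G) : x \in [set: G] -> excess x by [].
have := le_trans (sum_degree_sq R com exS) (splus_degree G0).
rewrite cardsT -[X in _ + X]mulr1 -mulrDr subrK ler_pM2l // ltr0n //.
Qed.

Lemma support_forms k (f : 'I_k -> G) (c : 'I_k -> R) (v : G -> R) :
  injective f -> (forall x, v x = \sum_i c i * (f i == x)%:R) ->
  dot v v = \sum_i c i ^+ 2 /\
  qform v = \sum_i \sum_j adjr (f i) (f j) * (c i * c j).
Proof.
move=> f_inj vE.
have sumv (F : G -> R) : \sum_x v x * F x = \sum_i c i * F (f i).
  transitivity (\sum_x \sum_i c i * (f i == x)%:R * F x).
    by apply: eq_bigr => x _; rewrite vE mulr_suml.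
  rewrite exchange_big; apply: eq_bigr => i _ /=.
  under eq_bigr do rewrite -mulrA [_ == _]eq_sym.
  by rewrite -mulr_sumr sum_delta.
split.
  rewrite /dot sumv; apply: eq_bigr => i _.
  rewrite vE (bigD1 i) //= eqxx mulr1 big1 ?addr0 ?expr2 //.
  by move=> j ji; rewrite (inj_eq f_inj) (negbTE ji) mulr0.
transitivity (\sum_x v x * \sum_y v y * adjr x y).
  apply: eq_bigr => x _; rewrite mulr_sumr; apply: eq_bigr => y _; ring.
rewrite sumv; apply: eq_bigr => i _; rewrite sumv mulr_sumr; apply: eq_bigr => j _; ring.
Qed.

(** Combines two gains over [n - 1]: [#|S| / n] in [lambda_1^2] from excess vertices, and [th^2]
    from [lambda_2], tested on vectors supported by [k] vertices. *)
Lemma splus_two_dim_support k (f : 'I_k -> G) (c1 c2 : 'I_k -> R) (th : R)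
    (S : {set G}) :
  (0 < #|G|)%N -> injective f -> 0 <= th ->
  (forall x, x \in S -> excess x) ->
  (forall s t : R, (s != 0) || (t != 0) -> let c i := s * c1 i + t * c2 i in
     0 < \sum_i c i ^+ 2 /\
     th * (\sum_i c i ^+ 2) <= \sum_i \sum_j adjr (f i) (f j) * (c i * c j)) ->
  #|G|%:R * (#|G|%:R - 1) + #|S|%:R <= #|G|%:R * (splus R G - th ^+ 2).
Proof.
move=> G0 f_inj th0 exS cP; apply: le_trans (sum_degree_sq R com exS) _.
pose v (c : 'I_k -> R) x := \sum_i c i * (f i == x)%:R.
apply: (splus_two_dim (v1 := v c1) (v2 := v c2)) => // s t st w.
have wE x : w x = \sum_i (s * c1 i + t * c2 i) * (f i == x)%:R.
  rewrite /w /v !mulr_sumr -big_split; apply: eq_bigr => i _ /=; ring.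
have [-> ->] := support_forms f_inj wE; exact: cP.
Qed.

(** On combinations of the indicators of the two edges [qform] equals [dot], so [th = 1], just what
    [lambda_1^2 >= n - 1] lacks. *)
Lemma splus_2K2 (x y z t : G) : adj x y -> adj z t ->
  ~~ adj x z -> ~~ adj x t -> ~~ adj y z -> ~~ adj y t ->
  #|G|%:R <= splus R G.
Proof.
move=> xy zt xz xt yz yt.
have G0 : (0 < #|G|)%N by rewrite (cardD1 x).
pose f (i : 'I_4) := nth x [:: x; y; z; t] i.
have f_inj : injective f.
  have u : uniq [:: x; y; z; t].
    rewrite /= !inE !negb_or !andbT -!andbA; apply/and5P; split; [| | | |apply/andP; split].
    - by apply: contraTneq xy => ->; rewrite adj_irr.
    - by apply: contraNneq xt => ->.
    - by apply: contraNneq xz => ->; rewrite adj_sym.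
    - by apply: contraNneq yt => ->.
    - by apply: contraNneq yz => ->; rewrite adj_sym.
    - by apply: contraTneq zt => ->; rewrite adj_irr.
  by move=> i j /eqP; rewrite nth_uniq // => /eqP/val_inj.
have ex0 : forall w : G, w \in set0 -> excess w by move=> w; rewrite inE.
pose c1 (i : 'I_4) : R := nth 0 [:: 1; 1; 0; 0] i.
pose c2 (i : 'I_4) : R := nth 0 [:: 0; 0; 1; 1] i.
have := splus_two_dim_support (c1 := c1) (c2 := c2) G0 f_inj ler01 ex0.
rewrite cards0 addr0 expr1n ler_pM2l ?ltr0n // lerD2r; apply=> r s rs c.
have nE u v : ~~ adj u v -> (@adjr R G u v = 0) * (@adjr R G v u = 0).
  by move=> uv; rewrite [adjr v u]adjrC /adjr (negbTE uv).
have yE u v : adj u v -> (@adjr R G u v = 1) * (@adjr R G v u = 1).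
  by move=> uv; rewrite [adjr v u]adjrC /adjr uv.
have zE u : @adjr R G u u = 0 by rewrite /adjr adj_irr.
rewrite !big_ord_recl !big_ord0 /c /c1 /c2 /f /= !zE.
rewrite !(nE _ _ xz, nE _ _ xt, nE _ _ yz, nE _ _ yt, yE _ _ xy, yE _ _ zt).
split; last by rewrite le_eqVlt; apply/orP; left; apply/eqP; ring.
have : 0 < r ^+ 2 + s ^+ 2.
  have := sqr_ge0 r; have := sqr_ge0 s; have [r0|rn] := eqVneq r 0.
    by move: rs; rewrite r0 eqxx /= => sn _ _; rewrite expr0n /= add0r exprn_even_gt0.
  by move=> s2 _; rewrite ltr_wpDr // exprn_even_gt0.
lra.
Qed.

(* The test matrix is [1/2 q p p^T + 1/2 v v^T], the sum of the positive parts of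
   the spanning star centred at [c] and of the edge [x y]. *)
Lemma splus_universal_edge (c x y : G) : (forall z, z != c -> adj c z) ->
  x != c -> y != c -> adj x y -> #|G|%:R <= splus R G.
Proof.
move=> cP xc yc xy; have xny : x != y by apply: contraTneq xy => ->; rewrite adj_irr.
have Gc : #|G|%:R = (#|predC1 c|%:R + 1 : R) by rewrite cardC1 natr1 prednK // (cardD1 c).
have N0 : 0 < #|predC1 c|%:R :> R by rewrite ltr0n; apply/card_gt0P; exists x.
set N : R := #|predC1 c|%:R in Gc N0; pose q := Num.sqrt N.
have q0 : 0 < q by rewrite sqrtr_gt0.
have qE : N = q ^+ 2 by rewrite sqr_sqrtr // ltW.
(* The eigenvector of the star for its eigenvalue [q], the square root of the number of leaves. *)
pose p z : R := if z == c then 1 else q^-1.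
pose v z : R := (z == x)%:R + (z == y)%:R.
have q2 : 0 <= q / 2 by rewrite divr_ge0 // ltW.
have h2 : 0 <= 2^-1 :> R by rewrite invr_ge0.
have sumN (u : R) : \sum_(z | z != c) u = N * u.
  by rewrite sumr_const mulr_natl.
have ppE : dot p p = 2.
  rewrite /dot (bigD1 c) //= {1 2}/p eqxx mulr1.
  rewrite (eq_bigr (fun=> q^-1 * q^-1)) => [|z /negbTE zc]; last by rewrite /p zc.
  rewrite sumN qE; field; lra.
have pvE : dot p v = 2 / q.
  rewrite /dot; under eq_bigr do rewrite mulrDr 2!(mulrC (p _)).
  rewrite big_split /= (sum_delta x p) (sum_delta y p) /p (negbTE xc) (negbTE yc).
  by field; lra.
have vvE : dot v v = 2.
  rewrite /dot; under eq_bigr do rewrite {1}/v mulrDl.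
  rewrite big_split /= (sum_delta x v) (sum_delta y v) /v !eqxx [y == x]eq_sym (negbTE xny).
  by rewrite addr0 add0r.
have qvE : qform v = 2.
  transitivity (\sum_z v z * \sum_w v w * @adjr R G z w).
    apply: eq_bigr => z _; rewrite mulr_sumr; apply: eq_bigr => w _; ring.
  have sv (F : G -> R) : \sum_z v z * F z = F x + F y.
    under eq_bigr do rewrite /v mulrDl.
    by rewrite big_split /= !sum_delta.
  by rewrite !sv /adjr !adj_irr [adj y x]adj_sym xy addr0 add0r.
have qpE : 2 * q + 2 / q ^+ 2 <= qform p.
  (* [b] keeps from the form of [p] only the star edges and the edge [x y], in both orders. *)
  pose b z w : R := (z == c)%:R * ((w != c)%:R / q) + (w == c)%:R * ((z != c)%:R / q)
    + (z == x)%:R * ((w == y)%:R / q ^+ 2) + (w == x)%:R * ((z == y)%:R / q ^+ 2).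
  apply: (@le_trans _ _ (\sum_z \sum_w b z w)).
    have nc : \sum_(w : G) (w != c)%:R / q = q.
      have cN : \sum_(w : G) (w != c)%:R = N :> R.
        rewrite /N -sum1_card natr_sum [RHS]big_mkcond; apply: eq_bigr => w _.
        by rewrite !inE; case: eqP.
      by rewrite -mulr_suml cN qE; field; lra.
    have ny : \sum_(w : G) (w == y)%:R / q ^+ 2 = (q ^+ 2)^-1.
      by rewrite (sum_delta y (fun=> _)).
    have d1 (u : G) (F : G -> R) (K : R) : \sum_w F w = K ->
        \sum_z \sum_w (z == u)%:R * F w = K /\ \sum_z \sum_w (w == u)%:R * F z = K.
      move=> FK; split; last rewrite exchange_big /=.
        by under eq_bigr do rewrite -mulr_sumr; rewrite (sum_delta u (fun=> _)).
      by under eq_bigr do rewrite -mulr_sumr; rewrite (sum_delta u (fun=> _)).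
    under eq_bigr do rewrite !big_split /=.
    rewrite !big_split /= (d1 c _ _ nc).1 (d1 c _ _ nc).2 (d1 x _ _ ny).1 (d1 x _ _ ny).2.
    by rewrite le_eqVlt; apply/orP; left; apply/eqP; field; lra.
  have qi : 0 < q^-1 by rewrite invr_gt0.
  have p0 z : 0 <= p z by rewrite /p; case: ifP => _; rewrite ?ltW.
  apply: ler_sum => z _; apply: ler_sum => w _.
  have app : 0 <= @adjr R G z w * (p z * p w) by rewrite !mulr_ge0 ?adjr_ge0.
  rewrite /b; case: (eqVneq z c) => [zc|zc]; case: (eqVneq w c) => [wc|wc] /=.
  - rewrite zc wc !(eq_sym c) (negbTE xc) (negbTE yc); by move: app; rewrite zc wc
      ?(mulr0n, mulr1n, mul0r, mulr0, addr0, add0r, mul1r, mulr1).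
  - rewrite zc !(eq_sym c) (negbTE xc) (negbTE yc) /adjr cP // /p eqxx (negbTE wc)
      ?(mulr0n, mulr1n, mul0r, mulr0, addr0, add0r, mul1r, mulr1); lra.
  - rewrite wc !(eq_sym c) (negbTE xc) (negbTE yc) /adjr adj_sym cP // /p eqxx (negbTE zc)
      ?(mulr0n, mulr1n, mul0r, mulr0, addr0, add0r, mul1r, mulr1); lra.
  rewrite !mul0r !add0r /p (negbTE zc) (negbTE wc).
  have qq : (q ^+ 2)^-1 = q^-1 * q^-1 by rewrite expr2 invfM.
  have qi2 : 0 <= q^-1 * q^-1 by rewrite mulr_ge0 ?ltW.
  rewrite qq; case: (eqVneq z x) => [zx|zx]; case: (eqVneq w y) => [wy|wy] /=.
  - rewrite zx wy /adjr xy (negbTE xny) [y == x]eq_sym (negbTE xny)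
      ?(mulr0n, mulr1n, mul0r, mulr0, addr0, add0r, mul1r, mulr1); lra.
  - by rewrite zx (negbTE xny) !mul0r !mulr0 addr0 mulr_ge0 ?adjr_ge0.
  - by rewrite wy [y == x]eq_sym (negbTE xny) !mul0r addr0 mulr_ge0 ?adjr_ge0.
  - case: (eqVneq w x) => [wx|wx]; case: (eqVneq z y) => [zy|zy];
      rewrite ?mul0r ?mulr0 ?addr0 ?mulr_ge0 ?adjr_ge0 ?(ltW qi) //.
    rewrite zy wx /adjr adj_sym xy
      ?(mulr0n, mulr1n, mul0r, mulr0, addr0, add0r, mul1r, mulr1); lra.
(* The gain [2 / q] of the edge [x y] in [qform p] cancels the cross term of [p] and [v];
   [q^2 + 1 = n] remains. *)
have := splus_test p v q2 h2; rewrite ppE vvE pvE qvE; apply: le_trans.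
have : q / 2 * (2 * q + 2 / q ^+ 2) <= q / 2 * qform p by rewrite ler_wpM2l.
have -> : q / 2 * (2 * q + 2 / q ^+ 2) = q ^+ 2 + q^-1 by field; lra.
have -> : 2 * (q / 2) / 2 * (2 / q) ^+ 2 = 2 * q^-1 by field; lra.
rewrite Gc qE => H.
have -> : (q / 2) ^+ 2 * 2 ^+ 2 = q ^+ 2 by field.
lra.
Qed.

End LowerBounds.

Lemma universal_star (G : sgraph) (c : G) : (forall z, z != c -> adj c z) ->
  (forall x y, x != c -> y != c -> ~~ adj x y) -> isomorphic G (star #|G|).
Proof.
move=> cP ind; have G0 : (0 < #|G|)%N by rewrite (cardD1 c).
(* The transposition moves the rank of [c] to 0, the centre of [star]. *)
pose f (x : G) := tperm (Ordinal G0) (enum_rank c) (enum_rank x).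
have f_inj : injective f by move=> x y /perm_inj/enum_rank_inj.
exists f; split; first by apply: inj_card_bij; rewrite ?card_ord.
have f0 x : (f x == 0 :> nat)%N = (x == c).
  have f_c : f c = Ordinal G0 by rewrite /f tpermR.
  by rewrite -(inj_eq f_inj) f_c -val_eqE.
move=> x y; rewrite /= /star_rel !f0.
have [->|xc] := eqVneq x c; have [->|yc] := eqVneq y c => /=.
- by rewrite adj_irr.
- by rewrite cP.
- by rewrite adj_sym cP.
- by rewrite (negbTE (ind _ _ xc yc)).
Qed.

(** * Graphs with neither a universal vertex nor an induced [2 K_2] *)

Section Free.
Variable G : sgraph.
Hypothesis com : forall x y : G,
  x != y -> ~~ adj x y -> exists2 w, adj x w & adj w y.
Hypothesis nouniv : forall x : G, exists2 z, z != x & ~~ adj x z.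
Hypothesis no2K2 : forall x y z t : G, adj x y -> adj z t ->
  [|| adj x z, adj x t, adj y z | adj y t].

Let neq (x y : G) : adj x y -> x != y.
Proof. by apply: contraTneq => ->; rewrite adj_irr. Qed.

Let no2K2_2 (w u b c : G) : adj w u -> adj b c -> ~~ adj w b -> ~~ adj w c ->
  adj u b || adj u c.
Proof. by move=> wu bc /negbTE wb /negbTE wc; have := no2K2 wu bc; rewrite wb wc. Qed.

(** [w] has a second neighbour [u], found through a non-neighbour of [a]. The edges [w u] and [b c]
    are not an induced [2 K_2], so [u] is adjacent to [b] or [c], which closes a 4-cycle through [w]
    and [a]. *)
Lemma excess_pendant (a b c w : G) : adj a b -> adj a c -> adj b c ->
  adj w a -> ~~ adj w b -> ~~ adj w c -> excess w.
Proof.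
move=> ab ac bc wa wb wc; have [z za az] := nouniv a.
have [u wu ua] : exists2 u, adj w u & u != a.
  have [wz|wz] := boolP (adj w z); first by exists z.
  have zw : w != z by apply: contraNneq az => <-; rewrite adj_sym.
  have [u wu uz] := com zw wz; exists u => //.
  by apply: contraNneq az => <-.
have bw : b != w by apply: contraNneq wc => <-.
have cw : c != w by apply: contraNneq wb => <-; rewrite adj_sym.
rewrite eq_sym in ua.
have /orP[ub|uc] := no2K2_2 wu bc wb wc.
  exact: (excess_square bw ua).
exact: (excess_square cw ua).
Qed.

(** Each of two neighbours [u], [u'] of [w] meets every edge of the triangle, as there is no induced
    [2 K_2]. Both are thus adjacent to at least two corners and share one. *)
Lemma excess_far (a b c w : G) : adj a b -> adj a c -> adj b c ->
  a != w -> b != w -> c != w ->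
  ~~ adj w a -> ~~ adj w b -> ~~ adj w c -> excess w.
Proof.
move=> ab ac bc aw bw cw wa wb wc.
have wna : w != a by rewrite eq_sym.
have [u wu ua] := com wna wa.
have [u' wu' uu'] : exists2 u', adj w u' & u != u'.
  have [z zu uz] := nouniv u.
  have [wz|wz] := boolP (adj w z); first by exists z; rewrite // eq_sym.
  have zw : w != z by apply: contraNneq uz => <-; rewrite adj_sym.
  have [t wt tz] := com zw wz; exists t => //.
  by apply: contraNneq uz => ->.
have sq v : v != w -> adj u v -> adj u' v -> excess w.
  by move=> vw uv uv'; exact: (excess_square vw uu').
have := no2K2_2 wu' ab wa wb; have := no2K2_2 wu' ac wa wc.
have := no2K2_2 wu' bc wb wc; have ubc := no2K2_2 wu bc wb wc.
case: (boolP (adj u' a)) => [u'a *|_ /= H1 H2 H3]; first exact: (sq a).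
by case/orP: ubc => [ub|uc]; [exact: (sq b)|exact: (sq c)].
Qed.

Lemma excess_of_triangle (a b c : G) : adj a b -> adj a c -> adj b c ->
  forall w : G, excess w.
Proof.
move=> ab ac bc w.
have [ba ca cb] : [/\ adj b a, adj c a & adj c b] by rewrite ![adj _ a]adj_sym [adj c b]adj_sym.
have [<-|aw] := eqVneq a w; first exact: (excess_triangle ab ac).
have [<-|bw] := eqVneq b w; first exact: (excess_triangle ba bc).
have [<-|cw] := eqVneq c w; first exact: (excess_triangle ca cb).
have [wa|wa] := boolP (adj w a); have [wb|wb] := boolP (adj w b);
  have [wc|wc] := boolP (adj w c).
- exact: (excess_triangle wa wb).
- exact: (excess_triangle wa wb).
- exact: (excess_triangle wa wc).
- exact: (excess_pendant ab ac bc).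
- exact: (excess_triangle wb wc).
- exact: (excess_pendant ba bc ac).
- exact: (excess_pendant ca cb ab).
- exact: (excess_far ab ac bc).
Qed.

Hypothesis no_triangle : forall x y z : G, adj x y -> adj y z -> ~~ adj x z.

Let nt (x y z : G) : adj x y -> adj x z -> adj y z -> False.
Proof. by move=> xy xz yz; have := no_triangle xy yz; rewrite xz. Qed.

(** Such a graph is complete bipartite ([cross]): a common neighbour of non-adjacent [p'] and [q']
    would close a triangle with [a] or [b]. As neither end is universal, both sides have a second
    vertex, and every vertex is on a 4-cycle. *)
Lemma excess_of_dominating_edge (a b : G) : adj a b ->
  (forall w, w != a -> w != b -> adj a w || adj b w) -> forall w : G, excess w.
Proof.
move=> ab dom w; have ba : adj b a by rewrite adj_sym.
have [q qa aq] := nouniv a; have [p pb bp] := nouniv b.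
have bq : adj b q.
  have := dom q qa; rewrite (negbTE aq); apply.
  by apply: contraNneq aq => ->.
have ap : adj a p.
  have := dom p; rewrite (negbTE bp) orbF; apply => //.
  by apply: contraNneq bp => ->.
have cross p' q' : adj a p' -> adj b q' -> adj p' q'.
  move=> ap' bq'; apply: contraT => npq.
  have pq : p' != q' by apply/eqP => pq; rewrite -pq in bq'; exact: (nt ab ap').
  have [u pu uq] := com pq npq.
  have ua : u != a.
    apply/eqP => ua; rewrite ua in uq; exact: (nt ab uq).
  have ub : u != b.
    apply/eqP => ub; rewrite ub in pu; apply: (nt ap' ab pu).
  by have /orP[au|bu] := dom u ua ub; [case: (nt ap' au pu)|case: (nt bu bq' uq)].
have [->|wa] := eqVneq w a.
  by apply: (excess_square qa _ ab bq ap (cross _ _ ap bq)); rewrite eq_sym.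
have [->|wb] := eqVneq w b.
  apply: (excess_square pb _ ba ap bq); first by rewrite eq_sym.
  by rewrite adj_sym cross.
have /orP[aw|bw] := dom w wa wb.
  have wq := cross _ _ aw bq.
  have bnw : b != w by rewrite eq_sym.
  apply: (excess_square bnw _ _ ab wq); rewrite 1?eq_sym // adj_sym //.
have pw := cross _ _ ap bw.
have anw : a != w by rewrite eq_sym.
by apply: (excess_square anw _ _ ba (w' := p)); rewrite 1?eq_sym // adj_sym.
Qed.

(** Only the sides are required: without triangles, the chords are absent and the vertices
    distinct. *)
Definition pentagon (s : seq G) :=
  if s is [:: a; b; c; d; e] then
    [&& adj a b, adj b c, adj c d, adj d e & adj e a]
  else false.

Lemma pentagonS a b c d e : pentagon [:: a; b; c; d; e] ->
  pentagon [:: b; c; d; e; a].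
Proof. by case/and5P => *; apply/and5P. Qed.

Lemma pentagon_chords a b c d e : pentagon [:: a; b; c; d; e] ->
  [/\ ~~ adj a c, ~~ adj b d, ~~ adj c e, ~~ adj d a & ~~ adj e b].
Proof.
case/and5P => ab bc cd de ea.
by split; [exact: no_triangle ab bc|exact: no_triangle bc cd|exact: no_triangle cd de
  |exact: no_triangle de ea|exact: no_triangle ea ab].
Qed.

Lemma pentagon_uniq s : pentagon s -> uniq s.
Proof.
case: s => [|a [|b [|c [|d [|e []]]]]] // P.
have [ac bd ce da eb] := pentagon_chords P; case/and5P: P => ab bc cd de ea.
rewrite /= !inE !negb_or !(neq ab, neq bc, neq cd, neq de) [a == e]eq_sym (neq ea) /= !andbT.
have ne (x y z : G) : adj x y -> ~~ adj z y -> x != z.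
  by move=> xy; apply: contraNneq => <-.
have [ba cb dc ed ae] : [/\ adj b a, adj c b, adj d c, adj e d & adj a e].
  by rewrite adj_sym ab adj_sym bc adj_sym cd adj_sym de adj_sym ea.
apply/and3P; split; [apply/andP; split|apply/andP; split|].
- exact: (ne _ e).
- by apply: (ne _ b); rewrite // adj_sym.
- by apply: (ne _ a).
- by apply: (ne _ c); rewrite // adj_sym.
- exact: (ne _ b).
Qed.

(** The edge [v a] and the opposite side [c d] must be joined, and [a] has no chord to [c] or
    [d]. *)
Lemma pentagon_twin a b c d e v : pentagon [:: a; b; c; d; e] ->
  v \notin [:: a; b; c; d; e] -> adj v a -> adj v c || adj v d.
Proof.
move=> P vC va; have [ac bd ce da eb] := pentagon_chords P.
case/and5P: P => ab bc cd de ea; have := no2K2 va cd.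
by rewrite (negbTE ac) [adj a d]adj_sym (negbTE da) !orbF.
Qed.

(** Otherwise a common neighbour [u] of [v] and [a], tested on the sides [b c] and [d e], is
    adjacent to both [c] and [d]: a triangle. *)
Lemma pentagon_adj a b c d e v : pentagon [:: a; b; c; d; e] ->
  v \notin [:: a; b; c; d; e] ->
  [|| adj v a, adj v b, adj v c, adj v d | adj v e].
Proof.
move=> P vC; apply: contraT; rewrite !negb_or => /and5P[va vb vc vd ve].
have [ac bd ce da eb] := pentagon_chords P; case/and5P: P => ab bc cd de ea.
have vna : v != a by apply: contraNneq vC => ->; rewrite inE eqxx.
have [u vu ua] := com vna va.
have ub : ~~ adj u b by exact: no_triangle ua ab.
have ue : ~~ adj u e by apply: no_triangle ua _; rewrite adj_sym.
have := no2K2_2 vu bc vb vc; rewrite (negbTE ub) /= => uc.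
have := no2K2_2 vu de vd ve; rewrite (negbTE ue) orbF => ud.
by case: (nt uc ud cd).
Qed.

(** All four vertices are on the 4-cycle [v a b c]. *)
Lemma pentagon_excess2 a b c d e v : pentagon [:: a; b; c; d; e] ->
  v \notin [:: a; b; c; d; e] -> adj v a -> adj v c ->
  excess v /\ {in [:: a; b; c], forall x, excess x}.
Proof.
move=> P vC va vc; have [ac bd ce da eb] := pentagon_chords P.
have := pentagon_uniq P; rewrite /= !inE !negb_or -!andbA.
case/and5P => nab nac nad nae /and5P[nbc _ _ _ _].
case/and5P: P => ab bc cd de ea.
have [av cv] : adj a v /\ adj c v by rewrite ![adj _ v]adj_sym.
have [ba cb] : adj b a /\ adj c b by rewrite [adj b a]adj_sym [adj c b]adj_sym.
have bv : b != v by apply: contraNneq vC => <-; rewrite !inE eqxx !orbT.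
have vb : v != b by rewrite eq_sym.
have ca : c != a by rewrite eq_sym.
split; first exact: (excess_square bv nac va ab vc cb).
move=> x; rewrite !inE => /or3P[]/eqP ->.
- exact: (excess_square ca bv ab bc av vc).
- exact: (excess_square vb nac ba av bc cv).
- exact: (excess_square nac bv cb ba cv va).
Qed.

Lemma pentagon_rot k s : pentagon s -> pentagon (rot k s).
Proof.
case: s => [|a [|b [|c [|d [|e []]]]]] // P; rewrite /rot.
have P1 := pentagonS P; have P2 := pentagonS P1; have P3 := pentagonS P2.
have P4 := pentagonS P3.
by do 5?[case: k => [|k] //].
Qed.

(** Up to rotation [v] is adjacent to the first and third vertices, and [s'] consists of the last
    two. *)
Lemma pentagon_excess s v : pentagon s -> v \notin s ->
  excess v /\ exists2 s', size s' = 2%N & {in s, forall x, x \notin s' -> excess x}.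
Proof.
have key s1 : pentagon s1 -> v \notin s1 -> adj v (nth v s1 0) -> adj v (nth v s1 2) ->
    excess v /\ exists2 s', size s' = 2%N & {in s1, forall x, x \notin s' -> excess x}.
  case: s1 => [|a [|b [|c [|d [|e []]]]]] // P vC va vc.
  have [exv exC] := pentagon_excess2 P vC va vc; split => //.
  exists [:: d; e] => // x; rewrite !inE negb_or => xC /andP[/negbTE xd /negbTE xe].
  by apply: exC; move: xC; rewrite xd xe !orbF !inE.
have keyr k s1 : pentagon s1 -> v \notin s1 -> adj v (nth v (rot k s1) 0) ->
    adj v (nth v (rot k s1) 2) ->
    excess v /\ exists2 s', size s' = 2%N & {in s1, forall x, x \notin s' -> excess x}.
  move=> P vs h0 h2; have vr : v \notin rot k s1 by rewrite mem_rot.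
  have [exv [s' s'2 exs']] := key _ (pentagon_rot k P) vr h0 h2.
  by split=> //; exists s' => // x; rewrite -(mem_rot k); exact: exs'.
have keyh s1 : pentagon s1 -> v \notin s1 -> adj v (nth v s1 0) ->
    excess v /\ exists2 s', size s' = 2%N & {in s1, forall x, x \notin s' -> excess x}.
  case: s1 => [|a [|b [|c [|d [|e []]]]]] // P vC va.
  have /orP[vc|vd] := pentagon_twin P vC va; first exact: key.
  (* Rotating by 3 puts [d] first and [a] third. *)
  exact: (keyr 3).
move=> P vs.
have keyhr k : adj v (nth v (rot k s) 0) ->
    excess v /\ exists2 s', size s' = 2%N & {in s, forall x, x \notin s' -> excess x}.
  move=> h0; have vr : v \notin rot k s by rewrite mem_rot.
  have [exv [s' s'2 exs']] := keyh _ (pentagon_rot k P) vr h0.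
  by split=> //; exists s' => // x; rewrite -(mem_rot k); exact: exs'.
case: s P vs keyhr => [|a [|b [|c [|d [|e []]]]]] // P vC keyhr.
by have /or4P[h|h|h|/orP[h|h]] := pentagon_adj P vC;
  [apply: (keyhr 0%N)|apply: (keyhr 1%N)|apply: (keyhr 2%N)
  |apply: (keyhr 3%N)|apply: (keyhr 4%N)].
Qed.

End Free.

(** * Triangle-free graphs containing a pentagon *)

Section Pentagon.
Variables (G : sgraph) (s : seq G).
Hypothesis no_triangle : forall x y z : G, adj x y -> adj y z -> ~~ adj x z.
Hypothesis sP : pentagon s.

Lemma pentagon_C5 : (forall x, x \in s) -> isomorphic G C5.
Proof.
move: sP; case: s => [|a [|b [|c [|d [|e []]]]]] // P sG.
have [ac bd ce da eb] := pentagon_chords no_triangle P.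
have P_uniq := pentagon_uniq no_triangle P; case/and5P: P => ab bc cd de ea.
set l := [:: _; _; _; _; _] in sG P_uniq.
have ltl x : (index x l < 5)%N by rewrite -[5%N]/(size l) index_mem.
pose f (x : G) : C5 := Ordinal (ltl x).
have f_inj : injective f.
  by move=> x y /(congr1 val) /= /(congr1 (nth a l)); rewrite !nth_index.
have fK (i : 'I_5) : f (nth a l i) = i.
  by apply: ord_inj; exact: (index_uniq a (ltn_ord i : (i < size l)%N) P_uniq).
exists f; split; first by exists (fun i : 'I_5 => nth a l i) => // x; exact: nth_index.
suff H (i j : 'I_5) : adj (f (nth a l i)) (f (nth a l j)) = adj (nth a l i) (nth a l j).
  by move=> x y; have := H (f x) (f y); rewrite /= !nth_index.
rewrite !fK.
have symE (u v : G) : adj u v -> (adj u v = true) * (adj v u = true).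
  by rewrite [adj v u]adj_sym => ->.
have nsymE (u v : G) : ~~ adj u v -> (adj u v = false) * (adj v u = false).
  by rewrite [adj v u]adj_sym => /negbTE ->.
pose E := (symE _ _ ab, symE _ _ bc, symE _ _ cd, symE _ _ de, symE _ _ ea,
  nsymE _ _ ac, nsymE _ _ bd, nsymE _ _ ce, nsymE _ _ da, nsymE _ _ eb, @adj_irr G).
by case: i => -[|[|[|[|[|]]]]] // ?; case: j => -[|[|[|[|[|]]]]] // ?; rewrite /= E.
Qed.

Hypothesis com : forall x y : G,
  x != y -> ~~ adj x y -> exists2 w, adj x w & adj w y.
Hypothesis no2K2 : forall x y z t : G, adj x y -> adj z t ->
  [|| adj x z, adj x t, adj y z | adj y t].

(* Outside two vertices of the pentagon every vertex is in excess, which only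
   gives [lambda_1^2 >= n - 2 / n]; but [lambda_2] is at least the eigenvalue
   [(sqrt 5 - 1) / 2] of [C5], whose multiplicity is two. *)
Lemma splus_pentagon (R : rcfType) : (6 <= #|G|)%N -> #|G|%:R <= splus R G.
Proof.
move=> n6; have G0 : (0 < #|G|)%N by apply: leq_trans n6.
have s5 : size s = 5%N by move: sP; case: s => [|a [|b [|c [|d [|e []]]]]].
have s_uniq := pentagon_uniq no_triangle sP.
have /existsP[v vs] : [exists v, v \notin s].
  apply: contraLR n6 => /existsPn sG; rewrite -leqNgt -s5 -(card_uniqP s_uniq).
  by apply/subset_leq_card/subsetP => x _; have := sG x; rewrite negbK.
have exout x : x \notin s -> excess x.
  by move=> xs; have [] := pentagon_excess com no2K2 no_triangle sP xs.
have [_ [s' s'2 exs]] := pentagon_excess com no2K2 no_triangle sP vs.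
pose S := [set x | x \notin s'].
have exS x : x \in S -> excess x.
  by rewrite inE => xs'; have [xs|/exout//] := boolP (x \in s); exact: exs.
have cardS : (#|G| <= #|S| + 2)%N.
  have h2 : (#|s'| <= 2)%N by rewrite -s'2 card_size.
  have hS : (#|[predC s']| <= #|S|)%N.
    by rewrite subset_leq_card //; apply/subsetP => x; rewrite !inE.
  by rewrite -(cardC (mem s')) addnC leq_add.
have [x0 _] : exists x0 : G, true by exists v.
pose f (i : 'I_5) := nth x0 s i.
have f_inj : injective f.
  by move=> i j /eqP; rewrite nth_uniq ?s5 // => /eqP/val_inj.
pose th : R := (Num.sqrt 5 - 1) / 2.
have r5 : Num.sqrt 5 ^+ 2 = 5 :> R by rewrite sqr_sqrtr.
have r1 : 1 <= Num.sqrt 5 :> R by rewrite -[leLHS]sqrtr1 ler_sqrt // ler1n.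
have th0 : 0 <= th by rewrite divr_ge0 // subr_ge0.
have thE : th ^+ 2 = 1 - th.
  by rewrite /th expr_div_n sqrrB r5; field.
(* A deficit of [2 / n] is to be covered, at most [1 / 3] for [n >= 6]. *)
have th3 : 3^-1 <= th ^+ 2.
  rewrite thE /th; suff : Num.sqrt 5 <= 7 / 3 :> R by lra.
  rewrite -[leRHS]ger0_norm; last by lra.
  by rewrite -sqrtr_sqr ler_sqrt; lra.
(* [c1] and [c2] span the [th]-eigenspace of the pentagon: from starting values [1, 0] and [0, 1],
   each next coordinate is [th] times the current one minus the previous one. *)
pose c1 (i : 'I_5) : R := nth 0 [:: 1; 0; -1; - th; th] i.
pose c2 (i : 'I_5) : R := nth 0 [:: 0; 1; th; - th; -1] i.
have cP : (forall t u : R, (t != 0) || (u != 0) ->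
    let c := fun i : 'I_5 => t * c1 i + u * c2 i in
    0 < \sum_i c i ^+ 2 /\
    th * (\sum_i c i ^+ 2) <= \sum_i \sum_j adjr (f i) (f j) * (c i * c j)).
  move=> t u tu c.
  rewrite /c /c1 /c2 /f; move: sP; case: s => [|a0 [|b [|c0 [|d [|e []]]]]] // P.
  have [ac bd ce da eb] := pentagon_chords no_triangle P; case/and5P: P => ab bc cd de ea.
  have yE u1 v1 : adj u1 v1 -> (@adjr R G u1 v1 = 1) * (@adjr R G v1 u1 = 1).
    by move=> uv; rewrite [adjr v1 u1]adjrC /adjr uv.
  have nE u1 v1 : ~~ adj u1 v1 -> (@adjr R G u1 v1 = 0) * (@adjr R G v1 u1 = 0).
    by move=> uv; rewrite [adjr v1 u1]adjrC /adjr (negbTE uv).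
  have zE u1 : @adjr R G u1 u1 = 0 by rewrite /adjr adj_irr.
  rewrite !big_ord_recl !big_ord0 /= !zE.
  rewrite !(nE _ _ ac, nE _ _ bd, nE _ _ ce, nE _ _ da, nE _ _ eb).
  rewrite !(yE _ _ ab, yE _ _ bc, yE _ _ cd, yE _ _ de, yE _ _ ea).
  rewrite ?(mul0r, mul1r, mulr0, mulr1, addr0, add0r); split.
    have t2 : 0 < t ^+ 2 + u ^+ 2.
      have := sqr_ge0 t; have := sqr_ge0 u; have [t_0|tn] := eqVneq t 0.
        by move: tu; rewrite t_0 eqxx /= => un _ _; rewrite expr0n /= add0r exprn_even_gt0.
      by move=> u2 _; rewrite ltr_wpDr // exprn_even_gt0.
    rewrite addrA; apply: lt_le_trans t2 _; rewrite lerDl.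
    by rewrite !addr_ge0 ?sqr_ge0.
  set x2 := t * -1 + u * th; set x3 := t * - th + u * - th; set x4 := t * th + u * -1.
  (* The eigenvector equation at the five vertices. *)
  have e0 : th * t = u + x4 by rewrite /x4; ring.
  have e1 : th * u = t + x2 by rewrite /x2; ring.
  have e2 : th * x2 = u + x3.
    have -> : th * x2 = - (t * th) + u * th ^+ 2 by rewrite /x2; ring.
    by rewrite thE /x3; ring.
  have e3 : th * x3 = x2 + x4.
    have -> : th * x3 = - (t + u) * th ^+ 2 by rewrite /x3; ring.
    by rewrite thE /x2 /x4; ring.
  have e4 : th * x4 = x3 + t.
    have -> : th * x4 = t * th ^+ 2 - th * u by rewrite /x4; ring.
    by rewrite thE /x3; ring.
  have -> : th * (t ^+ 2 + (u ^+ 2 + (x2 ^+ 2 + (x3 ^+ 2 + x4 ^+ 2)))) =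
    th * t * t + th * u * u + th * x2 * x2 + th * x3 * x3 + th * x4 * x4 by ring.
  by rewrite e0 e1 e2 e3 e4 le_eqVlt; apply/orP; left; apply/eqP; ring.
have := splus_two_dim_support com (c1 := c1) (c2 := c2) G0 f_inj th0 exS cP.
set n : R := #|G|%:R.
have n6R : 6 <= n by rewrite ler_nat.
have SR : n <= #|S|%:R + 2 by rewrite -natrD ler_nat.
have nth3 : n / 3 <= n * th ^+ 2 by rewrite ler_pM2l //; lra.
move=> H; have n0 : 0 < n by lra.
rewrite -(ler_pM2l n0); move: H nth3; rewrite !mulrBr mulr1; lra.
Qed.

End Pentagon.

(** * Positive square energy in diameter 2 *)

Lemma splus_diam2 (R : rcfType) (G : sgraph) : has_diam G 2 ->
  ~ isomorphic G (star #|G|) -> ~ isomorphic G C5 -> #|G|%:R <= splus R G.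
Proof.
move=> diamG nstar nC5.
have com (x y : G) := @diam2_common G x y diamG.
have [v _] : exists v : G, true by case: diamG => -[x] _ _; exists x.
have G0 : (0 < #|G|)%N by rewrite (cardD1 v).
have [/existsP[c /forallP cP]|/existsPn nouniv0] :=
    boolP [exists c : G, [forall z, (z != c) ==> adj c z]].
  have {}cP z : z != c -> adj c z by move/implyP: (cP z).
  have [/existsP[x /existsP[y /and3P[xc yc xy]]]|/existsPn ind] :=
      boolP [exists x, exists y, [&& x != c, y != c & adj x y]].
    exact: (splus_universal_edge cP xc yc xy).
  case: nstar; apply: (universal_star cP) => x y xc yc.
  by have /existsPn/(_ y) := ind x; rewrite xc yc.
have nouniv (x : G) : exists2 z, z != x & ~~ adj x z.
  by have /forallPn[z] := nouniv0 x; rewrite negb_imply => /andP[zx xz]; exists z.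
have [/existsP[x /existsP[y /existsP[z /existsP[t]]]]|/existsPn no4] :=
    boolP [exists x : G, exists y : G, exists z : G, exists t : G,
      [&& adj x y, adj z t, ~~ adj x z, ~~ adj x t & ~~ adj y z && ~~ adj y t]].
  case/and5P => xy zt xz xt /andP[yz yt].
  exact: (splus_2K2 com xy zt xz xt yz yt).
have no2K2 (x y z t : G) : adj x y -> adj z t ->
    [|| adj x z, adj x t, adj y z | adj y t].
  move=> xy zt; have /existsPn/(_ y)/existsPn/(_ z)/existsPn/(_ t) := no4 x.
  by rewrite xy zt /= -!negb_or negbK.
have [/existsP[a /existsP[b /existsP[c /and3P[ab ac bc]]]]|/existsPn no3] :=
    boolP [exists a : G, exists b : G, exists c : G, [&& adj a b, adj a c & adj b c]].
  exact: (splus_excess com G0 (excess_of_triangle com nouniv no2K2 ab ac bc)).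
have no_triangle (x y z : G) : adj x y -> adj y z -> ~~ adj x z.
  move=> xy yz; have /existsPn/(_ y)/existsPn/(_ z) := no3 x.
  by rewrite xy yz andbT.
have [b vb] : exists b, adj v b.
  have [z zv vz] := nouniv v; rewrite eq_sym in zv.
  by have [b vb _] := com v z zv vz; exists b.
have [/existsP[w /and4P[wv wb nvw nbw]]|/existsPn dom] :=
    boolP [exists w, [&& w != v, w != b, ~~ adj v w & ~~ adj b w]]; last first.
  apply: (splus_excess com G0).
  apply: (excess_of_dominating_edge com nouniv no_triangle vb) => w wv wb.
  by have := dom w; rewrite wv wb /= -negb_or negbK.
rewrite eq_sym in wv; rewrite eq_sym in wb.
(* [w] is at distance 2 from both ends of the edge [v b]; the two common neighbours complete a
   pentagon. *)
have [p vp pw] := com v w wv nvw; have [q bq qw] := com b w wb nbw.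
have P : pentagon [:: v; b; q; w; p].
  by rewrite /= vb bq qw [adj w p]adj_sym pw [adj p v]adj_sym vp.
have [n6|n5] := leqP 6 #|G|; first exact: (splus_pentagon no_triangle P com no2K2 R n6).
case: nC5; apply: (pentagon_C5 no_triangle P) => x.
have s_uniq := pentagon_uniq no_triangle P.
have s_full : [:: v; b; q; w; p] =i predT.
  apply/subset_cardP; last by apply/subsetP.
  apply/eqP; rewrite eqn_leq subset_leq_card ?(card_uniqP s_uniq) //.
  exact/subsetP.
by rewrite s_full.
Qed.

Theorem theorem1p4 (R : realType) :
  (forall G : sgraph,
     has_diam G 2 ->
     ~ isomorphic G (star #|G|) ->
     ~ isomorphic G C5 ->
     (#|G|%:R : R) <= splus R G) /\
  (exists C : R, 0 < C /\
     forall G : sgraph,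
       (2 <= #|G|)%N ->
       has_diam G 2 ->
       (#|G|%:R : R) - C * Num.sqrt (#|G|%:R * ln (#|G|%:R : R)) <= sminus R G).
Proof.
split; first exact: splus_diam2.
by exists 4; split=> // G; exact: sminus_diam2.
Qed.
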